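(* For a CoPolish space $\mathbf{X}$ exactly one of the following cases holds: 1. $\mathbf{X}$ is Polish and $\mathrm{VC}_{\mathbf{X}}$ is continuous. 2. $\mathbf{X}$ is not countably-based, $\mathbf{X}$ is Fréchet-Urysohn, and $\mathrm{ACC}_{\mathbb{N}}\leq_{\mathrm{W}}^{\mathrm{t}}\mathrm{VC}_{\mathbf{X}}<_{\mathrm{W}}^{\mathrm{t}}\mathrm{LPO}$. 3. $\mathbf{X}$ is not Fréchet-Urysohn, and $\mathrm{LPO}\leq_{\mathrm{W}}^{\mathrm{t}}\mathrm{VC}_{\mathbf{X}}\leq_{\mathrm{W}}^{\mathrm{t}}\widehat{\left(\mathrm{id}:\Sigma_{\Pi^1_1}\to\Sigma\right)}$.
   Context: A represented space $\mathbf{X}=(X,\delta_X)$ is a set $X$ with a partial surjection $\delta_X:\subseteq\mathbb{N}^{\mathbb{N}}\to X$. A realizer $F\vdash f$ of a partial multivalued function $f:\subseteq\mathbf{X}\rightrightarrows\mathbf{Y}$ is a partial $F:\subseteq\mathbb{N}^{\mathbb{N}}\to\mathbb{N}^{\mathbb{N}}$ with $\delta_Y(F(p))\in f(\delta_X(p))$ for all $p\in\mathrm{dom}(f\circ\delta_X)$; $f$ is continuous if it has a continuous realizer. Topological Weihrauch reducibility: $f\leq_{\mathrm{W}}^{\mathrm{t}}g$ iff there are continuous $H,K:\subseteq\mathbb{N}^{\mathbb{N}}\to\mathbb{N}^{\mathbb{N}}$ such that $p\mapsto K(\langle p,G(H(p))\rangle)$ is a realizer of $f$ whenever $G\vdash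 g$. $f<_{\mathrm{W}}^{\mathrm{t}}g$ means $f\leq_{\mathrm{W}}^{\mathrm{t}}g$ and not $g\leq_{\mathrm{W}}^{\mathrm{t}}f$. The parallelization $\widehat{f}:\subseteq\mathbf{X}^{\mathbb{N}}\rightrightarrows\mathbf{Y}^{\mathbb{N}}$ applies $f$ to each component of a sequence. A CoPolish space is a topological space that is the direct limit of an increasing sequence of compact metrisable subspaces $\mathbf{X}_0\subseteq\mathbf{X}_1\subseteq\cdots$; it is regarded as a represented space via an admissible representation (i.e. a continuous representation $\delta$ such that every continuous $\phi:\subseteq\mathbb{N}^{\mathbb{N}}\to\mathbf{X}$ factors as $\phi=\delta\circ G$ for some continuous $G:\subseteq\mathbb{N}^{\mathbb{N}}\to\mathbb{N}^{\mathbb{N}}$). A topological space is Fréchet-Urysohn if the closure of any subset $M$ is the set of all limits of sequences in $M$. $\Sigma=\{\top,\bot\}$ is Sierpinski space, with $\delta_\Sigma(p)=\bot$ iff $p=0^\omega$. $\mathcal{O}(\mathbf{X})$ is the space of open subsets $U$ of $\mathbf{X}$, identified with their characteristic functions in $\mathcal{C}(\mathbf{X},\Sigma)$. $\mathcal{V}(\mathbf{X})$ is the represented space of closed subsets $A$ of $\mathbf{X}$, where $A$ is identified with $\{U\in\mathcal{O}(\mathbf{X})\mid U\cap A\neq\emptyset\}\in\mathcal{O}(\mathcal{O}(\mathbf{X}))$. Overt choice $\mathrm{VC}_{\mathbf{X}}:\subseteq\mathcal{V}(\mathbf{X})\rightrightarrows\mathbf{X}$ has domain $\{A\mid A\neq\emptyset\}$,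 and $x\in\mathrm{VC}_{\mathbf{X}}(A)$ iff $x\in A$. $\mathrm{ACC}_{\mathbb{N}}$ is the problem of finding an element of a given set $A$ in the family $\{\mathbb{N}\}\cup\{\mathbb{N}\setminus\{i\}\mid i\in\mathbb{N}\}$, where this family is represented by $\psi(0^\omega)=\mathbb{N}$ and $\psi(0^j(i+1)0^\omega)=\mathbb{N}\setminus\{i\}$. $\mathrm{LPO}:\mathbb{N}^{\mathbb{N}}\to\{0,1\}$ is defined by $\mathrm{LPO}(r)=1$ iff $\exists k\in\mathbb{N}\ r(k)=0$. The space $\Sigma_{\Pi^1_1}$ has the elements $\top$ and $\bot$, where $p\in\mathbb{N}^{\mathbb{N}}$ is a name of $\top$ iff $p$ codes a well-founded tree on $\mathbb{N}$, and a name of $\bot$ iff $p$ codes an ill-founded tree on $\mathbb{N}$; $\mathrm{id}:\Sigma_{\Pi^1_1}\to\Sigma$ maps $\top$ to $\top$ and $\bot$ to $\bot$. *)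

(* Defs.v *)
From HB Require Import structures.
From Stdlib Require Cantor.
From mathcomp Require Import all_boot all_order all_algebra.
From mathcomp Require Import all_classical all_reals topology.

Set Implicit Arguments.
Unset Strict Implicit.
Unset Printing Implicit Defensive.

Import choice.

Local Open Scope classical_set_scope.

Definition homeomorphic (X Y : topologicalType) : Prop :=
  exists (f : X -> Y) (g : Y -> X),
    [/\ continuous f, continuous g, cancel f g & cancel g f].

Definition metrizable (R : realType) (X : topologicalType) : Prop :=
  exists M : metricType R, homeomorphic X M.

(* [completeType] is not used because it excludes the empty space. *)
Definition complete_metric (R : realType) (M : metricType R) : Prop :=
  forall F : set_system M, ProperFilter F -> cauchy F -> exists x : M, F --> x.

Definition separable (X : topologicalType) : Prop :=
  exists2 D : set X, countable D & dense D.

Definition polish (R : realType) (X : topologicalType) : Prop :=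
  separable X /\
  exists2 M : metricType R, complete_metric M & homeomorphic X M.

Definition frechet_urysohn (X : topologicalType) : Prop :=
  forall M : set X,
    closure M = [set x | exists2 u : nat -> X,
                           (forall n, M (u n)) & u @ \oo --> x].

(* The coercion from [set X] to types equips each [K n] with its subspace
   topology; the last clause is the direct limit topology. *)
Definition copolish (R : realType) (X : topologicalType) : Prop :=
  exists K : nat -> set X,
    [/\ forall n, compact (K n) /\ metrizable R (K n),
        forall n, K n `<=` K n.+1,
        \bigcup_n K n = [set: X] &
        forall U : set X,
          open U <-> forall n, open ((@set_val X (K n)) @^-1` U)].

Definition baire := {ptws nat -> nat}.

Record partial_map (A B : Type) := PartialMap {
  graph :> A -> B -> Prop;
  graph_functional : forall a b c, graph a b -> graph a c -> b = c
}.

(* Continuity for the subspace topology on the domain. *)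
Definition pcontinuous (A B : topologicalType) (F : partial_map A B) : Prop :=
  forall V : set B, open V ->
    exists2 U : set A, open U & forall a b, F a b -> (U a <-> V b).

Definition bpair (p q : baire) : baire :=
  fun n => if odd n then q n./2 else p n./2.

Definition bproj (i : nat) (p : baire) : baire :=
  fun j => p (Cantor.to_nat (i, j)).

Record representation (X : Type) := Representation {
  name_of :> partial_map baire X;
  name_of_onto : forall x, exists p, name_of p x
}.

Record repspace := RepSpace {
  carrier :> Type;
  delta : representation carrier
}.

Definition admissible (X : topologicalType) (d : representation X) : Prop :=
  pcontinuous d /\
  forall phi : partial_map baire X, pcontinuous phi ->
    exists2 G : partial_map baire baire, pcontinuous G &
      forall p x, phi p x <-> exists2 q, G p q & d q x.

(* Partial multivalued functions; the domain is where the value is nonempty. *)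
Definition mfun (X Y : repspace) : Type := X -> set Y.

Definition mdom (X Y : repspace) (f : mfun X Y) : set X := [set x | f x !=set0].

Definition single (X Y : repspace) (f : X -> Y) : mfun X Y := fun x => [set f x].

Definition realizes (X Y : repspace) (F : partial_map baire baire) (f : mfun X Y) :=
  forall p x, delta X p x -> mdom f x ->
    exists q y, [/\ F p q, delta Y q y & f x y].

Definition mcontinuous (X Y : repspace) (f : mfun X Y) : Prop :=
  exists2 F, pcontinuous F & realizes F f.

Definition wgraph (H K G : partial_map baire baire) (p r : baire) : Prop :=
  exists q s, [/\ H p q, G q s & K (bpair p s) r].

Lemma wgraph_functional H K G p r r' :
  wgraph H K G p r -> wgraph H K G p r' -> r = r'.
Proof.
move=> [q [s [Hq Gs Kr]]] [q' [s' [Hq' Gs' Kr']]].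
move: Gs' Kr'; rewrite -(graph_functional Hq Hq') => Gs'.
by rewrite -(graph_functional Gs Gs'); apply: graph_functional.
Qed.

Definition wcomp (H K G : partial_map baire baire) : partial_map baire baire :=
  PartialMap (@wgraph_functional H K G).

Definition weihrauch_le (X Y Z W : repspace)
    (f : mfun X Y) (g : mfun Z W) : Prop :=
  exists H K : partial_map baire baire,
    [/\ pcontinuous H, pcontinuous K &
        forall G, realizes G g -> realizes (wcomp H K G) f].

Definition weihrauch_lt (X Y Z W : repspace)
    (f : mfun X Y) (g : mfun Z W) : Prop :=
  weihrauch_le f g /\ ~ weihrauch_le g f.

Lemma mkseq_eqP (p q : baire) k :
  mkseq p k = mkseq q k <-> forall i, (i < k)%N -> p i = q i.
Proof.
split=> [e i ik|e]; first by rewrite -(nth_mkseq 0 p ik) e nth_mkseq.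
by apply/eq_in_map => i; rewrite mem_iota => /e.
Qed.

Lemma nbhs_cyl (p : baire) (U : set baire) : nbhs p U ->
  exists k, forall q : baire, mkseq q k = mkseq p k -> U q.
Proof.
move=> Up; apply: contrapT => /forallNP nU.
have /choice[u uP] : forall k, exists q : baire, mkseq q k = mkseq p k /\ ~ U q.
  move=> k; have /existsNP[q] := nU k.
  by move=> /not_implyP[? ?]; exists q.
have cu : u @ \oo --> p.
  apply/cvg_sup => i; apply/cvg_image.
    by rewrite eqEsubset; split=> // j _; exists (fun=> j).
  move=> A /= /(@nbhs_singleton nat) Ai.
  exists [set q : baire | A (q i)]; last first.
    rewrite eqEsubset; split=> [j [q /= ? <-//]|j Aj].
    by exists (fun=> j).
  exists i.+1 => // n /= ni.
  by have /mkseq_eqP/(_ i ni) <- := esym (uP n).1.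
have [N _ /(_ N (leqnn N))] := cu _ Up.
by case: (uP N).
Qed.

Lemma open_cyl (U : set baire) :
  (forall p, U p -> exists k, forall q : baire, mkseq q k = mkseq p k -> U q) ->
  open U.
Proof.
move=> cU; rewrite openE => p /cU[k kU].
have FF : Filter (nbhs p) := nbhs_filter p.
have : nbhs p [set q : baire | forall i, (i < k)%N -> q i = p i].
  elim: k {kU} => [|k IH]; first by apply: filterE => q i; rewrite ltn0.
  have pk : nbhs p [set q : baire | q k = p k].
    exact: (@proj_continuous nat (fun=> nat) k p [set p k]).
  apply: filterS2 pk IH => q qk IH i; rewrite ltnS leq_eqVlt => /orP[/eqP->//|].
  exact: IH.
by apply: filterS => q qp; apply: kU; apply/mkseq_eqP.
Qed.

(* [a] codes the partial continuous function whose value at [p] is [q] when,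
   for each [n], the first nonzero entry of [a] among the codes of [n] followed
   by an initial segment of [p] is [q n + 1]. *)
Definition eta_graph (a p q : baire) : Prop :=
  forall n, exists2 k, a (CodeSeq.code (n :: mkseq p k)) = (q n).+1 &
    forall j, (j < k)%N -> a (CodeSeq.code (n :: mkseq p j)) = 0%N.

Lemma eta_functional a p q q' :
  eta_graph a p q -> eta_graph a p q' -> q = q'.
Proof.
move=> h h'; apply: funext => n; have [k ak lk] := h n; have [l al ll] := h' n.
case: (ltngtP k l) => kl.
- by have := ll _ kl; rewrite ak.
- by have := lk _ kl; rewrite al.
- by move: ak; rewrite kl al => -[].
Qed.

Definition eta (a : baire) : partial_map baire baire := PartialMap (@eta_functional a).

Lemma eta_universal (F : partial_map baire baire) : pcontinuous F ->
  exists a, forall p q, F p q -> eta a p q.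
Proof.
move=> cF.
pose P n (w : seq nat) v :=
  (exists p q, F p q /\ mkseq p (size w) = w) /\
  forall p q, F p q -> mkseq p (size w) = w -> q n = v.
have /choice[a aP] : forall m, exists y,
    (y = 0%N /\ forall n w v, m = CodeSeq.code (n :: w) -> ~ P n w v) \/
    exists n w v, [/\ m = CodeSeq.code (n :: w), P n w v & y = v.+1].
  move=> m; have [[n [w [v [mE Pv]]]]|nex] := pselect
    (exists n w v, m = CodeSeq.code (n :: w) /\ P n w v).
    by exists v.+1; right; exists n, w, v.
  by exists 0%N; left; split=> // n w v mE Pv; apply: nex; exists n, w, v.
exists a => p q Fpq n.
have ex : exists k, a (CodeSeq.code (n :: mkseq p k)) != 0%N.
  have oV : open [set r : baire | r n = q n].
    apply: open_cyl => r /= rn; exists n.+1 => s /mkseq_eqP/(_ n (ltnSn n)) ->.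
    exact: rn.
  have [U oU UP] := cF _ oV.
  have Up : U p by apply/(UP _ _ Fpq).
  have [k kU] := nbhs_cyl (open_nbhs_nbhs (conj oU Up)).
  exists k; case: (aP (CodeSeq.code (n :: mkseq p k))) => [[_]|].
    move=> /(_ n (mkseq p k) (q n) erefl) []; split.
      by exists p, q; rewrite size_mkseq.
    by move=> p' q' F'; rewrite size_mkseq => /kU/(UP _ _ F').
  by move=> [? [? [v [_ _ ->]]]].
exists (ex_minn ex); case: ex_minnP => k ak kmin; last first.
  move=> j jk; apply/eqP; apply: contraTT jk => /kmin.
  by rewrite leqNgt.
move: ak; case: (aP (CodeSeq.code (n :: mkseq p k))) => [[-> //]|].
move=> [n' [w [v [/(can_inj CodeSeq.codeK)[<- <-] [_ Pv] -> _]]]].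
by rewrite (Pv _ _ Fpq)// size_mkseq.
Qed.

Section FunctionSpace.
Variables X Y : repspace.

Definition cfun : Type := {f : X -> Y | mcontinuous (single f)}.

Definition cfun_name (a : baire) (f : cfun) : Prop :=
  realizes (eta a) (single (sval f)).

Lemma cfun_name_apply a (f : cfun) p x : cfun_name a f -> delta X p x ->
  exists2 q, eta a p q & delta Y q (sval f x).
Proof.
move=> af px; have [|q [y [pq qy fy]]] := af p x px; first by exists (sval f x).
by exists q => //; rewrite -[sval f x]fy.
Qed.

Lemma cfun_name_functional a f g : cfun_name a f -> cfun_name a g -> f = g.
Proof.
move=> fa ga; apply: eq_sig_hprop => [*|]; first exact: Prop_irrelevance.
apply: funext => x.
have [p px] := name_of_onto (delta X) x.
have [q pq qx] := cfun_name_apply fa px.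
have [q' pq' qx'] := cfun_name_apply ga px.
by apply: (graph_functional qx); rewrite (graph_functional pq pq').
Qed.

Lemma cfun_name_onto f : exists a, PartialMap cfun_name_functional a f.
Proof.
case: f => f [F cF Ff]; have [a aP] := eta_universal cF.
exists a => p x px dx; have [q [y [Fpq qy fy]]] := Ff p x px dx.
by exists q, y; split=> //; exact: aP.
Qed.

Definition cfun_space : repspace := RepSpace (Representation cfun_name_onto).

End FunctionSpace.

Lemma sierp_functional (p : baire) b c :
  (b = false <-> forall n, p n = 0%N) -> (c = false <-> forall n, p n = 0%N) ->
  b = c.
Proof.
case: b; case: c => // -[h k] [h' k'].
  by have := k (h' erefl).
by have := k' (h erefl).
Qed.

Definition sierp_name : partial_map baire bool := PartialMap sierp_functional.

Lemma sierp_name_onto b : exists p, sierp_name p b.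
Proof.
exists (fun=> nat_of_bool b); split=> [->//|/(_ 0%N)].
by case: b.
Qed.

(* [true] is top and [false] is bottom. *)
Definition sierpinski : repspace := RepSpace (Representation sierp_name_onto).

Definition open_space (X : repspace) : repspace := cfun_space X sierpinski.

Definition char (X : Type) (A : set X) : X -> bool := fun x => `[< A x >].

(* Open and closed subsets are those of the represented space: the
   characteristic function into [sierpinski] has a continuous realizer. *)
Definition rep_open (X : repspace) (U : set X) : Prop :=
  mcontinuous (@single X sierpinski (char U)).

Definition rep_closed (X : repspace) (A : set X) : Prop := rep_open (~` A).

Section Overt.
Variable X : repspace.

Definition meets (A : set X) : set (open_space X) :=
  [set U | exists2 x, A x & sval U x = true].

Lemma meets_open (A : set X) : rep_open (meets A).
Proof.
pose b (p : baire) n := `[< forall p' (U : open_space X),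
   delta (open_space X) p' U -> mkseq p' n = mkseq p n -> meets A U >].
pose phi (p : baire) : baire := fun n => nat_of_bool (b p n).
have phiP : forall p r r' : baire, r = phi p -> r' = phi p -> r = r'.
  by move=> p r r' -> ->.
exists (PartialMap phiP).
  move=> V oV; exists [set p | V (phi p)]; last by move=> p _ /= ->.
  apply: open_cyl => p /= Vp.
  have [k kV] := nbhs_cyl (open_nbhs_nbhs (conj oV Vp)).
  exists k => q /mkseq_eqP qp; apply: kV; apply/mkseq_eqP => i ik.
  rewrite /phi /b; congr (nat_of_bool `[< _ >]).
  suff -> : mkseq q i = mkseq p i by [].
  by apply/mkseq_eqP => j ji; apply: qp; exact: ltn_trans ik.
move=> p U pU _; exists (phi p), (char (meets A) U); split=> //=.
rewrite /char; split=> [/negbT/asboolPn nU n|z].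
  by rewrite /phi /b; case: asboolP => // /(_ p U pU erefl).
apply/negbTE/asboolPn => -[x Ax Ux].
have [q qx] := name_of_onto (delta X) x.
have [s qs sx] := cfun_name_apply pU qx.
have [m sm] : exists m, s m <> 0%N.
  apply: contrapT => /forallNP s0; have /sx : forall n, s n = 0%N.
    by move=> n; apply: contrapT; exact: s0.
  by rewrite Ux.
have [k pk lk] := qs m.
pose c j := (CodeSeq.code (m :: mkseq q j)).
pose N := (\max_(j < k.+1) (c j)).+1.
have cN j : (j <= k)%N -> (c j < N)%N.
  by move=> jk; rewrite ltnS (leq_bigmax (Ordinal (jk : (j < k.+1)%N))).
suff : phi p N = 1%N by rewrite z.
rewrite /phi /b; case: asboolP => // -[] p' U' pU' /mkseq_eqP pp'.
exists x => //; have [s' qs' sx'] := cfun_name_apply pU' qx.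
apply/negP => /negP/negbTE/sx'/(_ m) s'm.
have [k' pk' lk'] := qs' m; move: pk'; rewrite s'm.
case: (ltngtP k' k) => [kk'|kk'|->].
- by rewrite pp' ?cN ?(ltnW kk')// lk.
- by have := lk' _ kk'; rewrite pp' ?cN// pk.
- by rewrite pp' ?cN// pk => -[].
Qed.

Definition meets_char (A : set X) : open_space (open_space X) :=
  exist _ (char (meets A)) (meets_open A).

Definition closed_subset : Type := {A : set X | rep_closed A}.

Definition closed_name (p : baire) (A : closed_subset) : Prop :=
  delta (open_space (open_space X)) p (meets_char (sval A)).

Lemma meets_subset (A B : closed_subset) :
  meets (sval A) `<=` meets (sval B) -> sval A `<=` sval B.
Proof.
case: A B => [A cA] [B cB] /= AB x Ax; apply: contrapT => nBx.
have [|y By /asboolP//] := AB (exist _ (char (~` B)) cB : open_space X).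
by exists x => //; apply/asboolP.
Qed.

Lemma closed_name_functional p A B :
  closed_name p A -> closed_name p B -> A = B.
Proof.
move=> pA pB; have /(congr1 sval) /= E := graph_functional pA pB.
apply: eq_sig_hprop => [*|]; first exact: Prop_irrelevance.
rewrite eqEsubset; split; apply: meets_subset => U.
  by move=> /asboolP; rewrite -/(char _ _) E => /asboolP.
by move=> /asboolP; rewrite -/(char _ _) -E => /asboolP.
Qed.

Lemma closed_name_onto A : exists p, PartialMap closed_name_functional p A.
Proof. exact: (name_of_onto (delta (open_space (open_space X)))). Qed.

Definition overt_space : repspace :=
  RepSpace (Representation closed_name_onto).

Definition VC : mfun overt_space X := fun A => sval A.

End Overt.

Arguments VC : clear implicits.

Section Sequences.
Variable X : repspace.

Definition seq_name (p : baire) (x : nat -> X) : Prop :=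
  forall i, delta X (bproj i p) (x i).

Lemma seq_name_functional p x y : seq_name p x -> seq_name p y -> x = y.
Proof.
by move=> px py; apply: funext => i; exact: graph_functional (px i) (py i).
Qed.

Lemma seq_name_onto x : exists p, PartialMap seq_name_functional p x.
Proof.
have /choice[q qx] : forall i, exists p, delta X p (x i).
  by move=> i; exact: name_of_onto.
exists (fun m => q (Cantor.of_nat m).1 (Cantor.of_nat m).2) => i /=.
suff -> : bproj i (fun m => q (Cantor.of_nat m).1 (Cantor.of_nat m).2) = q i.
  exact: qx.
by apply: funext => j; rewrite /bproj Cantor.cancel_of_to.
Qed.

Definition seq_space : repspace := RepSpace (Representation seq_name_onto).

End Sequences.

Definition parallelization (X Y : repspace) (f : mfun X Y) :
    mfun (seq_space X) (seq_space Y) :=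
  fun x => [set y | forall i, f (x i) (y i)].

Lemma baire_name_functional (p q r : baire) : p = q -> p = r -> q = r.
Proof. by move=> ->. Qed.

Lemma baire_name_onto (q : baire) : exists p, PartialMap baire_name_functional p q.
Proof. by exists q. Qed.

Definition baire_space : repspace := RepSpace (Representation baire_name_onto).

Lemma nat_name_functional (p : baire) m n : p 0%N = m -> p 0%N = n -> m = n.
Proof. by move=> ->. Qed.

Lemma nat_name_onto n : exists p, PartialMap nat_name_functional p n.
Proof. by exists (fun=> n). Qed.

Definition nat_space : repspace := RepSpace (Representation nat_name_onto).

Lemma bit_name_functional (p : baire) (b c : bool) :
  p 0%N = b -> p 0%N = c -> b = c.
Proof. by move=> ->; case: b; case: c. Qed.

Lemma bit_name_onto b : exists p, PartialMap bit_name_functional p b.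
Proof. by exists (fun=> nat_of_bool b). Qed.

Definition bit_space : repspace := RepSpace (Representation bit_name_onto).

Definition LPO : mfun baire_space bit_space :=
  @single baire_space bit_space (fun r : baire => `[< exists k, r k = 0%N >]).

Definition cosingleton : Type :=
  {A : set nat | A = [set: nat] \/ exists i, A = ~` [set i]}.

(* 0^omega names N and 0^j (i+1) 0^omega names N \ {i}. *)
Definition acc_name (p : baire) (A : cosingleton) : Prop :=
  (p = (fun=> 0%N) /\ sval A = [set: nat]) \/
  exists i j, p = (fun n => if n == j then i.+1 else 0%N) /\
              sval A = ~` [set i].

Lemma acc_name_functional p A B : acc_name p A -> acc_name p B -> A = B.
Proof.
move=> pA pB; apply: eq_sig_hprop => [*|]; first exact: Prop_irrelevance.
case: pA pB => [[-> ->]|[i [j [-> ->]]]] [[e ->]|[i' [j' [e ->]]]] //.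
- by have := congr1 (@^~ j') e; rewrite /= eqxx.
- by have := congr1 (@^~ j) e; rewrite /= eqxx.
- by have := congr1 (@^~ j) e; rewrite /= eqxx; case: eqP => // _ [->].
Qed.

Lemma acc_name_onto A : exists p, PartialMap acc_name_functional p A.
Proof.
case: A => A [AT|[i Ai]]; first by exists (fun=> 0%N); left.
by exists (fun n => if n == 0%N then i.+1 else 0%N); right; exists i, 0%N.
Qed.

Definition acc_space : repspace := RepSpace (Representation acc_name_onto).

Definition ACC : mfun acc_space nat_space := fun A => sval A.

Definition is_tree (T : pred (seq nat)) : Prop :=
  forall u v, T (u ++ v) -> T u.

(* [p] is the characteristic function of the tree [T]. *)
Definition codes_tree (p : baire) (T : pred (seq nat)) : Prop :=
  is_tree T /\ forall u, p (CodeSeq.code u) = nat_of_bool (T u).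

Definition ill_founded (T : pred (seq nat)) : Prop :=
  exists x : nat -> nat, forall n, T (mkseq x n).

Definition sierp_pi11_name (p : baire) (b : bool) : Prop :=
  exists T, codes_tree p T /\ (b = true <-> ~ ill_founded T).

Lemma sierp_pi11_functional p b c :
  sierp_pi11_name p b -> sierp_pi11_name p c -> b = c.
Proof.
move=> [T [[_ pT] bT]] [T' [[_ pT'] cT']].
have TT' : T = T'.
  apply: funext => u; have := pT u; rewrite pT'.
  by case: (T u); case: (T' u).
by subst T'; apply/idP/idP => [/bT/cT'|/cT'/bT].
Qed.

Lemma sierp_pi11_onto b : exists p, PartialMap sierp_pi11_functional p b.
Proof.
exists (fun=> nat_of_bool (~~ b)), (fun=> ~~ b); split; first by split.
case: b.
  by split=> // _ [x /(_ 0%N)].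
by split=> // h; exfalso; apply: h; exists id.
Qed.

Definition sierpinski_pi11 : repspace :=
  RepSpace (Representation sierp_pi11_onto).

Definition id_pi11 : mfun sierpinski_pi11 sierpinski :=
  @single sierpinski_pi11 sierpinski id.

Definition exactly_one (P Q S : Prop) : Prop :=
  [/\ P \/ Q \/ S, ~ (P /\ Q), ~ (P /\ S) & ~ (Q /\ S)].

(* Main.v *)
(** The space is the limit of compact metrisable [K n], and every continuous map
    from Baire space into it locally takes its values in a single [K n].  If each
    point is interior to some [K n], the space is locally compact and second
    countable, hence Polish, and a point of an overt set is found by following
    shrinking open sets that meet it.  Otherwise some [x] is interior to no [K n].

    In the Frechet-Urysohn case, [x] is for every [i] the limit of a sequence
    outside [K i], and the index [i] can be avoided by a point of such sequences
    once a name of it has committed to some [K n]: this gives ACC.  There are only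
    finitely many such [x] in each [K n], so they form a closed discrete set, and
    it suffices to ask LPO whether the overt set meets the complement.  LPO is not
    reducible: the answers A_n for sequences whose first zero is at n accumulate at
    every point of the answer A for the sequence without zero, hence some points
    of A_n converge to a point of A, where a continuous function cannot jump.

    If the space is not Frechet-Urysohn, some [x] is in the closure of a set M but
    not of any M `&` K n: [x] is separated from M by a finite part of any of its
    names, although {x} is a limit of finite subsets of M, which gives LPO.  For
    the upper bound, a compact set has a neighbourhood base indexed by Baire space,
    so that an overt set meets it iff a tree of attempts to avoid it is
    well-founded; then one follows shrinking compact sets that meet the overt
    set. *)

From HB Require Import structures.
From mathcomp Require Import all_boot all_order all_algebra ring lra.
From mathcomp Require Import all_classical all_reals topology normedtype.
Require Import Defs.

Set Implicit Arguments.
Unset Strict Implicit.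
Unset Printing Implicit Defensive.

Import Order.TTheory GRing.Theory Num.Theory numFieldTopology.Exports.
Local Open Scope classical_set_scope.

(** * Topology of CoPolish spaces *)

Lemma open_nbhs_sub (X : topologicalType) (U : set X) :
  (forall x, U x -> exists V, [/\ open V, V x & V `<=` U]) -> open U.
Proof.
move=> h; rewrite openE => x /h [V [oV Vx VU]].
by rewrite /interior nbhsE; exists V.
Qed.

Lemma compact_increasing_cover (X : topologicalType) (C : set X)
    (U : nat -> set X) : compact C -> (forall n, open (U n)) ->
  (forall n, U n `<=` U n.+1) -> C `<=` \bigcup_n U n -> exists n, C `<=` U n.
Proof.
move=> cC oU Uincr CU.
have mono : forall m n, (m <= n)%N -> U m `<=` U n.
  move=> m n; elim: n => [|n IH]; first by rewrite leqn0 => /eqP ->.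
  by rewrite leq_eqVlt => /orP[/eqP ->//|/IH h]; apply: subset_trans (Uincr n).
have /compact_near_coveringP nC := cC.
have [|N _ NP] := nC nat \oo (fun n x => U n x) _.
  move=> x Cx; have [n _ Unx] := CU _ Cx.
  exists (U n, [set k | (n <= k)%N]).
    split=> /=; last by exists n.
    exact: open_nbhs_nbhs.
  by move=> [y k] /= [Uy nk]; exact: (mono n).
by exists N; exact: (NP N (leqnn N)).
Qed.

Lemma compact_decreasing_bigcap (X : topologicalType) (S : nat -> set X) :
  compact (S 0%N) -> (forall n, closed (S n)) -> (forall n, S n.+1 `<=` S n) ->
  (forall n, S n !=set0) -> \bigcap_n S n !=set0.
Proof.
move=> cS clS Sdecr Sn0; apply: contrapT => nex.
have [|||n nP] := @compact_increasing_cover _ (S 0%N) (fun n => ~` S n) cS.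
- by move=> n; exact: closed_openC.
- by move=> n; exact: subsetC.
- move=> x S0x; apply: contrapT => nx; apply: nex; exists x => n _.
  by apply: contrapT => nS; apply: nx; exists n.
have S0 m : S m `<=` S 0%N.
  by elim: m => [//|m IH]; exact: subset_trans IH.
have [x Sx] := Sn0 n.
exact: (nP x (S0 n x Sx)).
Qed.

Lemma open_set_typeP (X : topologicalType) (A : set X) (W : set A) : open W <->
  exists2 V : set X, open V & W = (@set_val X A) @^-1` V.
Proof. by split=> [[V oV <-]|[V oV ->]]; exists V. Qed.

Lemma compact_set_type (X : topologicalType) (A : set X) :
  compact A -> compact [set: A].
Proof.
move=> /compact_near_coveringP nA; apply/compact_near_coveringP => I F P FF h.
have : \near F, A `<=` fun x => forall Ax : x \in A, P F (exist _ x Ax).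
  apply: nA => x /mem_set Ax.
  have [[U V] /= [Ux FV] UV] := h (exist _ x Ax) Logic.I.
  move: Ux; rewrite nbhsE => -[W [oW Wx] WU].
  have [W' oW' W'E] := (open_set_typeP W).1 oW.
  exists (W', V); first split=> //=.
    apply: open_nbhs_nbhs; split=> //.
    by move: Wx; rewrite W'E.
  move=> [y i] /= [W'y Vi] Ay; apply: (UV (exist _ y Ay, i)); split=> //=.
  by apply: WU; rewrite W'E.
by apply: filterS => i iA [x Ax] _; exact: iA (set_mem Ax) _.
Qed.

Lemma compact_surj (X Y : topologicalType) (f : X -> Y) :
  continuous f -> compact [set: X] -> (forall y, exists x, f x = y) ->
  compact [set: Y].
Proof.
move=> cf /compact_near_coveringP nX sf.
apply/compact_near_coveringP => I F P FF h.
have : \near F, [set: X] `<=` fun x => P F (f x).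
  apply: nX => x _.
  have [[U V] /= [Ux FV] UV] := h (f x) Logic.I.
  exists (f @^-1` U, V); first by split=> //=; exact: cf.
  by move=> [y i] /= [Uy Vi]; exact: (UV (f y, i)).
by apply: filterS => i iX y _; have [x <-] := sf y; exact: iX.
Qed.

Lemma metric_second_countable (R : realType) (M : metricType R) :
  compact [set: M] -> @second_countable M.
Proof.
(* [compact_second_countable] is about pointed spaces, so the empty space is treated apart. *)
move=> cM; have [[x0 _]|M0] := pselect (exists x : M, True).
  pose P : pseudoPMetricType R := HB.pack M (isPointed.Build M x0).
  exact: (@compact_second_countable R P).
by exists set0 => //; split=> // x; exfalso; apply: M0; exists x.
Qed.

Lemma homeomorphic_hausdorff (X Y : topologicalType) :
  homeomorphic X Y -> hausdorff_space Y -> hausdorff_space X.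
Proof.
move=> [f [g [cf cg fK gK]]] hY x y xy; apply: (can_inj fK); apply: hY => A B Ax By.
have [z [Az Bz]] := xy _ _ (cf _ _ Ax) (cf _ _ By).
by exists (f z).
Qed.

Lemma second_countable_seq (X : topologicalType) : @second_countable X ->
  exists V : nat -> set X, (forall i, open (V i)) /\
    forall x (U : set X), open U -> U x -> exists i, V i x /\ V i `<=` U.
Proof.
move=> [B /countable_injP[f fI] [Bo Bb]].
(* The [i]-th set is the base member with code [i], and is empty when [i] codes none. *)
exists (fun i x => exists U : set X, [/\ B U, f U = i & U x]); split.
  move=> i; apply: open_nbhs_sub => x [U [BU fU Ux]].
  by exists U; split=> //; [exact: Bo | move=> y Uy; exists U].
move=> x U oU Ux; have [W [BW Wx] WU] := Bb x U (open_nbhs_nbhs (conj oU Ux)).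
exists (f W); split; first by exists W.
by move=> y [W' [BW' /fI W'W W'y]]; apply: WU; rewrite -W'W ?inE.
Qed.

Lemma homeomorphic_second_countable (X Y : topologicalType) :
  homeomorphic X Y -> @second_countable Y -> @second_countable X.
Proof.
move=> [f [g [cf cg fK gK]]] [B cB [Bo Bb]].
exists [set f @^-1` U | U in B]; first exact: sub_countable (card_image_le _ _) cB.
split=> [_ [U BU <-]|x A].
  by move/continuousP: cf; apply; exact: Bo.
rewrite nbhsE => -[U [oU Ux] UA].
have /(Bb (f x)) [W [BW Wx] WU] : nbhs (f x) (g @^-1` U).
  by apply: open_nbhs_nbhs; split=> /=; [move/continuousP: cg; apply|rewrite fK].
exists (f @^-1` W); first by split=> //; exists W.
by move=> y /WU /=; rewrite fK => /UA.
Qed.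

(** Asking that almost all [W m] lie in [U] replaces the monotonicity of the base. *)
Definition first_countable_at (X : topologicalType) (x : X) :=
  exists W : nat -> set X, (forall n, nbhs x (W n)) /\
    forall U, nbhs x U -> exists n, forall m, (n <= m)%N -> W m `<=` U.

(** A finite intersection of those [V i] that contain [x]; it turns an enumerated base into a
    decreasing neighbourhood base. *)
Lemma countable_nbhs (X : topologicalType) (V : nat -> set X) (x : X) n :
  (forall i, open (V i)) ->
  nbhs x [set y | forall i, (i < n)%N -> V i x -> V i y].
Proof.
move=> oV; elim: n => [|n IH]; first by apply: filterS filterT => y _ i.
have [Vx|nVx] := pselect (V n x).
  apply: filterS2 (open_nbhs_nbhs (conj (oV n) Vx)) IH => y Vy Wy i.
  by rewrite ltnS leq_eqVlt => /orP[/eqP ->//|]; exact: Wy.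
apply: filterS IH => y Wy i.
by rewrite ltnS leq_eqVlt => /orP[/eqP ->//|]; exact: Wy.
Qed.

Lemma second_countable_first_countable (X : topologicalType) (x : X) :
  @second_countable X -> first_countable_at x.
Proof.
move=> /second_countable_seq[V [oV VP]].
exists (fun n => [set y | forall i, (i < n)%N -> V i x -> V i y]); split.
  by move=> n; exact: countable_nbhs.
move=> B; rewrite nbhsE => -[U [oU Ux] UB]; have [i [Vx VU]] := VP x U oU Ux.
by exists i.+1 => n ni y Wy; exact/UB/VU/Wy.
Qed.

Lemma first_countable_frechet_urysohn (X : topologicalType) :
  (forall x : X, first_countable_at x) -> frechet_urysohn X.
Proof.
move=> fc M; apply/seteqP; split=> [x clx|x [u uM ux] B /ux[N _ NB]]; last first.
  by exists (u N); split=> //; exact: (NB N (leqnn N)).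
have [W [xW WU]] := fc x.
have /choice[u uP] n : exists y, M y /\ W n y.
  by have [y [My Wy]] := clx _ (xW n); exists y.
exists u; first by move=> n; have [] := uP n.
by move=> U /WU[n nU]; exists n => // m nm; apply: (nU m nm); have [] := uP m.
Qed.

(** The consequences of being a direct limit of compact metrisable spaces, with subspace topologies
    expressed by traces of open sets of [X]: [tower_open] is the limit topology, [tower_base] and
    [tower_separate] are second countability and normality of [K n]. *)
Record tower (X : topologicalType) (K : nat -> set X) : Prop := Tower {
  tower_compact : forall n, compact (K n);
  tower_closed : forall n, closed (K n);
  tower_incr : forall m n, (m <= n)%N -> K m `<=` K n;
  tower_cover : forall x, exists n, K n x;
  tower_set1 : forall x : X, closed [set x];
  tower_open : forall U : set X,
    (forall n x, U x -> K n x -> exists V, [/\ open V, V x & K n `&` V `<=` U]) ->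
    open U;
  tower_base : forall n, exists V : nat -> set X, (forall i, open (V i)) /\
    forall x (U : set X), open U -> U x -> K n x ->
      exists i, V i x /\ K n `&` V i `<=` U;
  tower_separate : forall n (A B : set X), closed A -> closed B ->
    K n `&` A `&` B = set0 -> exists U V, [/\ open U, open V,
      K n `&` A `<=` U, K n `&` B `<=` V & K n `&` U `&` V = set0]
}.

Arguments tower_set1 {X K} _ x.
Arguments tower_closed {X K} _ n.
Arguments tower_compact {X K} _ n.

Lemma copolish_tower (R : realType) (X : topologicalType) :
  copolish R X -> exists K : nat -> set X, tower K.
Proof.
move=> [K [Kcm Kincr Kcov Kopen]]; exists K.
have incr m n : (m <= n)%N -> K m `<=` K n.
  elim: n => [|n IH]; first by rewrite leqn0 => /eqP ->.
  by rewrite leq_eqVlt => /orP[/eqP ->//|/IH h]; apply: subset_trans (Kincr n).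
have cov x : exists n, K n x.
  have : [set: X] x by [].
  by rewrite -Kcov => -[n _ Kx]; exists n.
have Topen (U : set X) :
    (forall n x, U x -> K n x -> exists V, [/\ open V, V x & K n `&` V `<=` U]) ->
    open U.
  move=> h; apply/Kopen => n; apply: open_nbhs_sub => -[x Kx] /= Ux.
  have [V [oV Vx VU]] := h n x Ux (set_mem Kx).
  exists (set_val @^-1` V); split=> //; first by apply/open_set_typeP; exists V.
  by move=> [y Ky] Vy; apply: VU; split=> //; exact: set_mem.
have haus n : hausdorff_space (K n).
  have [_ [M hM]] := Kcm n.
  exact: homeomorphic_hausdorff hM (metric_hausdorff (T := M)).
have cK n : compact [set: K n] by apply: compact_set_type; have [] := Kcm n.
have base n : @second_countable (K n).
  have [_ [M hM]] := Kcm n; apply: homeomorphic_second_countable (hM) _.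
  apply: metric_second_countable; case: hM => f [g [cf cg fK gK]].
  by apply: (compact_surj cf (@cK n)) => y; exists (g y).
(* The inclusion of the compact [K m] into the Hausdorff [K n] has compact, hence closed, image; the
   limit topology then makes [K m] closed in [X]. *)
have sub_closed m n : (m <= n)%N -> closed ((@set_val X (K n)) @^-1` (K m)).
  move=> mn; apply: compact_closed; first exact: haus.
  pose h (y : K m) : K n :=
    exist _ (set_val y) (mem_set (incr _ _ mn _ (set_mem (valP y)))).
  have ch : continuous h.
    apply/continuousP => W /open_set_typeP[V oV ->].
    by apply/open_set_typeP; exists V.
  suff -> : set_val @^-1` K m = h @` setT.
    apply: continuous_compact; last exact: cK.
    exact: continuous_subspaceT.
  rewrite eqEsubset; split=> [[y Ky] Kmy|_ [[y Ky] _ <-]]; last exact: set_mem.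
  by exists (exist _ y (mem_set Kmy)) => //; exact/eq_sig_hprop.
split=> //.
- by move=> n; have [] := Kcm n.
- move=> n; rewrite -[X in closed X]setCK; apply: open_closedC.
  apply: Topen => m x nKx Kmx.
  have nm : (n <= m)%N.
    by rewrite leqNgt; apply/negP => /ltnW /incr /(_ x Kmx).
  have /closed_openC/open_set_typeP[V oV VE] := sub_closed n m nm.
  have VP y (Ky : K m y) : V y <-> ~ K n y.
    by have := congr1 (fun P => P (exist _ y (mem_set Ky))) VE => /= ->.
  exists V; split=> //; first exact/VP.
  by move=> y [Kmy Vy]; apply/VP.
- move=> x; rewrite -[X in closed X]setCK; apply: open_closedC.
  apply: Topen => n y xy Ky.
  have [Kx|nKx] := pselect (K n x); last first.
    exists setT; split=> //; first exact: openT.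
    by move=> z [Kz _] /= zx; apply: nKx; rewrite -zx.
  have /hausdorff_accessible/accessible_closed_set1 := @haus n.
  move=> /(_ (exist _ x (mem_set Kx))) /closed_openC/open_set_typeP[V oV VE].
  have VP z (Kz : K n z) : V z <-> z <> x.
    have := congr1 (fun P => P (exist _ z (mem_set Kz))) VE => /= <-.
    split=> [nzx zx|zx /(congr1 val)//].
    by apply: nzx; exact: eq_sig_hprop.
  by exists V; split=> //; [exact/VP | move=> z [Kz /VP]; exact].
- move=> n; have [V [oV VP]] := second_countable_seq (base n).
  have /choice[W WP] i : exists W, open W /\ V i = set_val @^-1` W.
    by have /open_set_typeP[W ? ->] := oV i; exists W.
  exists W; split=> [i|x U oU Ux Kx]; first by have [] := WP i.
  have [||i [Vx VU]] := VP (exist _ x (mem_set Kx)) (set_val @^-1` U).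
  + by apply/open_set_typeP; exists U.
  + exact: Ux.
  have [_ ViE] := WP i; rewrite ViE in Vx VU.
  exists i; split=> // y [Ky Wy].
  exact: (VU (exist _ y (mem_set Ky))).
- move=> n A B cA cB AB.
  have /(@normal_openP R) nK := compact_normal (@haus n) (cK n).
  have pc (D : set X) : closed D -> closed ((@set_val X (K n)) @^-1` D).
    move=> cD; rewrite -[X in closed X]setCK; apply: open_closedC.
    by apply/open_set_typeP; exists (~` D) => //; exact: closed_openC.
  have [|U [V [/open_set_typeP[U' oU ->] /open_set_typeP[V' oV ->] AU BV UV]]] :=
      nK _ _ (pc _ cA) (pc _ cB).
    apply/seteqP; split=> // -[y Ky] /= [Ay By].
    have : (K n `&` A `&` B) y by split=> //; split=> //; exact: set_mem.
    by rewrite AB.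
  exists U', V'; split=> //.
  + by move=> y [Ky Ay]; exact: (AU (exist _ y (mem_set Ky))).
  + by move=> y [Ky Ay]; exact: (BV (exist _ y (mem_set Ky))).
  apply/seteqP; split=> // y [[Ky Uy] Vy].
  have : ((@set_val X (K n)) @^-1` U' `&` set_val @^-1` V') (exist _ y (mem_set Ky)).
    by [].
  by rewrite UV.
Qed.

Lemma dependent_choice_nat (S : Type) (P : nat -> S -> Prop)
    (Q : nat -> S -> S -> Prop) :
  (exists s, P 0%N s) ->
  (forall n s, P n s -> exists2 t, P n.+1 t & Q n s t) ->
  exists s : nat -> S, forall n, P n (s n) /\ Q n (s n) (s n.+1).
Proof.
move=> [s0 Ps0] step.
have /choice[f fP] : forall x : nat * S,
    exists t, P x.1 x.2 -> P x.1.+1 t /\ Q x.1 x.2 t.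
  move=> [n s] /=; have [/step[t Pt Qt]|nP] := pselect (P n s).
    by exists t.
  by exists s => /nP.
pose s := fix s n := if n is m.+1 then f (m, s m) else s0.
have Ps n : P n (s n).
  by elim: n => [//|n IH]; exact: (fP (n, s n) IH).1.
by exists s => n; split=> //; exact: (fP (n, s n) (Ps n)).2.
Qed.

(** * Separation and bases in direct limits of compact metrisable spaces *)

Section Tower.
Variables (X : topologicalType) (K : nat -> set X).
Hypothesis hK : tower K.

Lemma tower_closed_finite (A : set X) : finite_set A -> closed A.
Proof.
move: A; apply: accessible_finite_set_closed.1 => x y xy.
exists (~` [set y]); split; first by apply: closed_openC; exact: (tower_set1 hK).
- by rewrite inE /=; exact/eqP.
- by rewrite inE /=; exact.
Qed.

(** A trace of [O n] on [K n] is open in [K n] only, but the later sets [O m] contain it, so near a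
    point of [K n] the open set [O (maxn j n)] has its trace on [K n] inside the union. *)
Lemma tower_bigcup_open (O : nat -> set X) : (forall n, open (O n)) ->
  (forall n, K n `&` O n `<=` O n.+1) -> open (\bigcup_n (K n `&` O n)).
Proof.
move=> oO Oincr; have mono m n : (m <= n)%N -> K m `&` O m `<=` O n.
  elim: n => [|n IH]; first by rewrite leqn0 => /eqP -> x [].
  rewrite leq_eqVlt => /orP[/eqP -> x []//|mn x KOx].
  apply: Oincr; split; last exact: IH.
  exact: (tower_incr hK (mn : (m <= n)%N)) KOx.1.
apply: (tower_open hK) => n x [j _ [Kx Ox]] Knx.
exists (O (maxn j n)); split=> //; first by apply: mono (leq_maxl _ _) _ _; split.
move=> y [Ky Oy]; exists (maxn j n) => //; split=> //.
exact: (tower_incr hK (leq_maxr _ _)) Ky.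
Qed.

(** Separating twice gives disjoint closures: after [U] is found, the closure of its trace is itself
    separated from [B], and [V'] stays away from a neighbourhood of that closure. *)
Lemma tower_strong_separate n (A B : set X) : closed A -> closed B ->
    K n `&` A `&` B = set0 -> exists U V, [/\ open U, open V,
      K n `&` A `<=` U, K n `&` B `<=` V &
      closure (K n `&` U) `&` closure (K n `&` V) = set0].
Proof.
have disj (U V : set X) : open V -> K n `&` U `&` V = set0 ->
    closure (K n `&` U) `&` V = set0.
  move=> oV UV; apply/seteqP; split=> // x [clx Vx].
  have [y [KUy Vy]] := clx V (open_nbhs_nbhs (conj oV Vx)).
  by have : (K n `&` U `&` V) y by []; rewrite UV.
move=> cA cB AB.
have [U [V [oU oV AU BV UV]]] := tower_separate hK cA cB AB.
have clUV := disj _ _ oV UV.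
have [|U' [V' [oU' oV' AU' BV' UV']]] :=
    @tower_separate _ _ hK n (closure (K n `&` U)) B (@closed_closure _ _) cB.
  apply/seteqP; split=> // x [[Kx clx] Bx].
  by rewrite -clUV; split=> //; exact: BV.
exists U, V'; split=> //.
rewrite setIC; apply/seteqP; split=> // x [clV clU].
have KVU : K n `&` V' `&` U' = set0 by rewrite -UV' -!setIA (setIC U').
have : (closure (K n `&` V') `&` U') x.
  split=> //; apply: AU'; split=> //.
  rewrite (closure_id (K n)).1; first by apply: closureS clU => ? [].
  exact: (tower_closed hK).
by rewrite disj.
Qed.

Lemma tower_normal (A B : set X) : closed A -> closed B -> A `&` B = set0 ->
  exists U V, [/\ open U, open V, A `<=` U, B `<=` V & U `&` V = set0].
Proof.
(* Grow relatively open sets with disjoint closures from [K n] to [K n.+1]. *)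
move=> cA cB AB.
pose P n (s : set X * set X) := [/\ open s.1, open s.2,
  K n `&` A `<=` s.1, K n `&` B `<=` s.2 &
  closure (K n `&` s.1) `&` closure (K n `&` s.2) = set0].
pose Q n (s t : set X * set X) := K n `&` s.1 `<=` t.1 /\ K n `&` s.2 `<=` t.2.
have clK n (W : set X) : closure (K n `&` W) `<=` K n.
  rewrite [X in _ `<=` X](closure_id (K n)).1; first by apply: closureS => ? [].
  exact: (tower_closed hK).
have KS n : K n `<=` K n.+1 by exact: (tower_incr hK).
have [||s sP] := @dependent_choice_nat _ P Q.
- have [|U [V UV]] := @tower_strong_separate 0 A B cA cB; last by exists (U, V).
  by rewrite -setIA AB setI0.
- move=> n [U V] [/= oU oV AU BV UV].
  have [|||U' [V' [oU' oV' AU' BV' UV']]] := @tower_strong_separate n.+1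
      (closure (K n `&` U) `|` A) (closure (K n `&` V) `|` B).
  + by apply: closedU => //; exact: closed_closure.
  + by apply: closedU => //; exact: closed_closure.
  (* In the mixed cases the closures lie in [K n], where the traces of [A] and [B] are already
     inside [U] and [V]. *)
  + apply/seteqP; split=> // x [[_ [clU|Ax]] [clV|Bx]].
    * by rewrite -UV.
    * have : (closure (K n `&` U) `&` closure (K n `&` V)) x.
        split=> //; apply: subset_closure; split; first exact: clK clU.
        by apply: BV; split=> //; exact: clK clU.
      by rewrite UV.
    * have : (closure (K n `&` U) `&` closure (K n `&` V)) x.
        split=> //; apply: subset_closure; split; first exact: clK clV.
        by apply: AU; split=> //; exact: clK clV.
      by rewrite UV.
    * by rewrite -AB.
  exists (U', V'); split=> //=.
  + by move=> x [Kx Ax]; apply: AU'; split=> //; right.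
  + by move=> x [Kx Bx]; apply: BV'; split=> //; right.
  + move=> x KUx; apply: AU'; split; first exact/KS/(clK n U)/subset_closure.
    by left; exact: subset_closure.
  + move=> x KVx; apply: BV'; split; first exact/KS/(clK n V)/subset_closure.
    by left; exact: subset_closure.
have s1 m n : (m <= n)%N -> K m `&` (s m).1 `<=` K n `&` (s n).1.
  elim: n => [|n IH]; first by rewrite leqn0 => /eqP ->.
  rewrite leq_eqVlt => /orP[/eqP ->//|/IH h]; apply: subset_trans h _.
  by move=> x [Kx sx]; split; [exact: KS | exact: (sP n).2.1].
have s2 m n : (m <= n)%N -> K m `&` (s m).2 `<=` K n `&` (s n).2.
  elim: n => [|n IH]; first by rewrite leqn0 => /eqP ->.
  rewrite leq_eqVlt => /orP[/eqP ->//|/IH h]; apply: subset_trans h _.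
  by move=> x [Kx sx]; split; [exact: KS | exact: (sP n).2.2].
exists (\bigcup_n (K n `&` (s n).1)), (\bigcup_n (K n `&` (s n).2)); split.
- apply: tower_bigcup_open => n; first by have [[]] := sP n.
  by have [_ []] := sP n.
- apply: tower_bigcup_open => n; first by have [[]] := sP n.
  by have [_ []] := sP n.
- move=> x Ax; have [n Kx] := tower_cover hK x; exists n => //; split=> //.
  by have [[_ _ h _ _] _] := sP n; exact: h.
- move=> x Bx; have [n Kx] := tower_cover hK x; exists n => //; split=> //.
  by have [[_ _ _ h _] _] := sP n; exact: h.
apply/seteqP; split=> // x [[i _ /(s1 _ _ (leq_maxl i _)) h1]].
move=> [j _ /(s2 _ _ (leq_maxr i j)) h2].
have [[_ _ _ _ <-] _] := sP (maxn i j).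
by split; exact: subset_closure.
Qed.

Lemma tower_regular (x : X) (U : set X) : open U -> U x ->
  exists W, [/\ open W, W x & closure W `<=` U].
Proof.
move=> oU Ux.
have [||W [V [oW oV xW UV WV]]] := @tower_normal [set x] (~` U) (tower_set1 hK x).
- exact: open_closedC.
- by apply/seteqP; split=> // y [-> ].
exists W; split=> //; first exact: xW.
move=> y clWy; apply: contrapT => nUy.
have [z] := clWy V (open_nbhs_nbhs (conj oV (UV _ nUy))).
by rewrite WV.
Qed.

Lemma tower_hausdorff_sep (x y : X) : x <> y ->
  exists U, [/\ open U, U x & ~ closure U y].
Proof.
move=> xy; have [||W [oW Wx WU]] := @tower_regular x (~` [set y]).
- by apply: closed_openC; exact: (tower_set1 hK).
- by [].
by exists W; split=> // /WU; exact.
Qed.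

(* The range of [v] is closed since it meets each [K n] in a finite set. *)
Lemma tower_escape (v : nat -> X) (x : X) : (forall n, ~ K n (v n)) ->
  exists U N, [/\ open U, U x & forall n, (N <= n)%N -> ~ U (v n)].
Proof.
(* The complement of the range, with [x] put back in case it is a term; since [K N] contains [x], no
   term of index at least [N] equals [x]. *)
move=> vK; exists (fun y => y = x \/ forall n, v n <> y).
have [N Kx] := tower_cover hK x.
exists N; split; last 2 first.
- by left.
- move=> n Nn [vx|]; last exact.
  by apply: (vK n); rewrite vx; exact: (tower_incr hK) Kx.
apply: (tower_open hK) => n y yW Kny.
exists (~` ([set v i | i in `I_n] `\ y)); split.
- apply: closed_openC; apply: tower_closed_finite.
  apply: (@sub_finite_set _ _ [set v i | i in `I_n]); first by move=> z [].
  by apply: finite_image; exact: finite_II.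
- by case=> _; apply.
move=> z [Kz nz]; have [<-|zy] := pselect (y = z); first by [].
right=> i vz; apply: nz; split; last by rewrite /= => /esym.
exists i => //=; rewrite ltnNge; apply/negP => ni.
by apply: (vK i); rewrite vz; exact: (tower_incr hK) Kz.
Qed.

(** Normality puts an open [W] between [C] and [U] with closure inside [U]; by compactness finitely
    many basic sets with trace inside [W] cover [C]. *)
Lemma tower_nbhs_compact n (C U : set X) (V : nat -> set X) :
  (forall i, open (V i)) ->
  (forall x (U : set X), open U -> U x -> K n x ->
      exists i, V i x /\ K n `&` V i `<=` U) ->
  C `<=` K n -> closed C -> open U -> C `<=` U ->
  exists s : seq nat, C `<=` [set x | exists2 i, i \in s & V i x] /\
    closure (K n `&` [set x | exists2 i, i \in s & V i x]) `<=` U.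
Proof.
move=> oV VP CK cC oU CU.
have [||W [W' [oW oW' CW UW WW]]] := @tower_normal C (~` U) cC.
- exact: open_closedC.
- by apply/seteqP; split=> // y [/CU].
pose T m := [set x | exists2 i, (i < m)%N /\ K n `&` V i `<=` W & V i x].
have cC' : compact C.
  exact: (subclosed_compact cC (tower_compact hK n) CK).
have [|||m Cm] := @compact_increasing_cover _ C T cC'.
- move=> m; apply: open_nbhs_sub => x [i [im iW] Vx]; exists (V i); split=> //.
  by move=> y Vy; exists i.
- by move=> m x [i [im iW] Vx]; exists i => //; split=> //; exact: ltnW.
- move=> x Cx; have [i [Vx iW]] := VP x W oW (CW _ Cx) (CK _ Cx).
  by exists i.+1 => //; exists i.
exists [seq i <- iota 0 m | `[< K n `&` V i `<=` W >]]; split.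
  move=> x /Cm[i [im iW] Vx]; exists i => //.
  by rewrite mem_filter mem_iota im /= andbT; apply/asboolP.
have sW : closure (K n `&` [set x | exists2 i,
    i \in [seq i <- iota 0 m | `[< K n `&` V i `<=` W >]] & V i x])
    `<=` closure W.
  apply: closureS => x [Kx [i]]; rewrite mem_filter => /andP[/asboolP iW _] Vx.
  exact: iW.
move=> x /sW clW; apply: contrapT => nUx.
have [z] := clW W' (open_nbhs_nbhs (conj oW' (UW _ nUx))).
by rewrite WW.
Qed.

(** A basic set of [K n], cut down to the interior of [K n], is open in [X]. Countably many such
    relatively compact sets form a base at all points of local compactness. *)
Lemma tower_locally_compact_base : exists O : nat -> set X,
  (forall i, exists n, open (O i) /\ O i `<=` K n) /\
  forall n x (U : set X), open U -> U x -> interior (K n) x ->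
    exists i, O i x /\ closure (O i) `<=` U.
Proof.
have /choice[V VP] := tower_base hK.
exists (fun i => if unpickle i is Some (n, j)
  then V n j `&` interior (K n) else set0); split.
  move=> i; case: unpickle => [[n j]|]; last by exists 0%N; split=> //; exact: open0.
  exists n; split; last by move=> x [_ /interior_subset].
  by apply: openI; [exact: (VP n).1 | exact: open_interior].
move=> n x U oU Ux Kx.
have [W [oW Wx WU]] := tower_regular oU Ux.
have [j [Vx VW]] := (VP n).2 x W oW Wx (interior_subset Kx).
exists (pickle (n, j)); rewrite pickleK; split=> //.
by apply: subset_trans WU; apply: closureS => y [Vy /interior_subset Ky]; exact: VW.
Qed.

(** Along a branch of nonempty sets the scheme closes in on a point, so the branch can serve as a
    name of that point. *)
Definition scheme (S : seq nat -> set X) := forall b : nat -> nat,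
  (forall n, S (mkseq b n) !=set0) -> exists x, (forall n, S (mkseq b n) x) /\
    forall U, open U -> U x -> exists n, S (mkseq b n) `<=` U.

(** Otherwise the compact sets left after removing [U] have a common point, which must be [x], a
    member of [U]. *)
Lemma scheme_limit (S : nat -> set X) x : compact (S 0%N) ->
  (forall n, closed (S n)) -> (forall n, S n.+1 `<=` S n) ->
  (forall y, (forall n, S n y) -> y = x) ->
  forall U, open U -> U x -> exists n, S n `<=` U.
Proof.
move=> cS clS Sdecr Sx U oU Ux; apply: contrapT => nex.
have clSU n : closed (S n `\` U).
  by apply: closedI; [exact: clS | exact: open_closedC].
have [||||y yP] := @compact_decreasing_bigcap _ (fun n => S n `\` U).
- apply: (subclosed_compact _ cS); last by move=> ? [].
  exact: clSU.
- exact: clSU.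
- by move=> n y [/Sdecr ? ?].
- move=> n; apply: contrapT => /set0P/negP/negPn/eqP SU.
  by apply: nex; exists n; rewrite -setD_eq0.
have yx : y = x by apply: Sx => n; have [] := yP n Logic.I.
by have [_] := yP 0%N Logic.I; rewrite yx.
Qed.

End Tower.

(** * Schemes of shrinking sets, and points without compact neighbourhoods *)

Section Schemes.
Variables (X : topologicalType) (K : nat -> set X).
Hypothesis hK : tower K.

Lemma compact_scheme n : exists S : seq nat -> set X,
  [/\ S [::] = K n, forall s, closed (S s), forall s, S s `<=` K n,
      forall s x, S s x -> exists i, S (rcons s i) x & scheme S].
Proof.
have [V [oV VP]] := tower_base hK n.
(* For each basic set, a branch chooses its closure or its complement. *)
pose T k j := if j == 0%N then closure (K n `&` V k) else ~` V k.
pose S s := [set x | K n x /\ forall k, (k < size s)%N -> T k (nth 0%N s k) x].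
have clT k j : closed (T k j).
  by rewrite /T; case: ifP => _; [exact: closed_closure | exact: open_closedC].
have clS s : closed (S s).
  rewrite (_ : S s = K n `&` \bigcap_(k in `I_(size s)) T k (nth 0%N s k)).
    by apply: closedI; [exact: (tower_closed hK) | apply: closed_bigI].
  by apply/seteqP; split=> x [Kx h]; split.
have SP b m x : S (mkseq b m) x <-> K n x /\ forall k, (k < m)%N -> T k (b k) x.
  split=> -[Kx h]; split=> // k.
    by move=> km; have := h k; rewrite size_mkseq nth_mkseq//; exact.
  by rewrite size_mkseq => km; rewrite nth_mkseq//; exact: h.
exists S; split=> //.
- by apply/seteqP; split=> [x []|x Kx].
- by move=> s x [].
- move=> s x [Kx h].
  have [i Ti] : exists i, T (size s) i x.
    have [Vx|nVx] := pselect (V (size s) x); last by exists 1%N.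
    by exists 0%N; apply: subset_closure; split.
  exists i; split=> // k; rewrite size_rcons ltnS leq_eqVlt nth_rcons.
  by move=> /orP[/eqP ->|ks]; rewrite ?ltnn ?eqxx// ks; exact: h.
move=> b Sb0.
have Sdecr m : S (mkseq b m.+1) `<=` S (mkseq b m).
  by move=> x /SP[Kx h]; apply/SP; split=> // k km; apply: h; exact: ltnW.
have cS0 : compact (S (mkseq b 0)).
  by apply: (subclosed_compact (clS _) (tower_compact hK n)); move=> x [].
have [x xS] := compact_decreasing_bigcap cS0 (fun m => clS (mkseq b m)) Sdecr Sb0.
have {}xS m : S (mkseq b m) x by exact: xS.
exists x; split=> //; apply: (scheme_limit cS0) => //.
move=> y yS; apply: contrapT => yx.
have [Kx Tx] := (SP b 0%N x).1 (xS 0%N).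
have [|U [oU Ux nUy]] := @tower_hausdorff_sep _ _ hK x y; first by move=> /esym.
have [k [Vx VU]] := VP x U oU Ux Kx.
have [_ /(_ k (ltnSn k))] := (SP b k.+1 x).1 (xS _).
have [_ /(_ k (ltnSn k))] := (SP b k.+1 y).1 (yS _).
(* Level [k] separates [x] from [y]: as [V k] contains [x], the branch must have taken the closure,
   which lies in the closure of [U] and so misses [y]. *)
rewrite /T; case: ifP => // _ clV _; apply: nUy.
exact: closureS clV.
Qed.

(** A name of an overt set reveals when it meets an open set, so a branch through open sets can be
    followed continuously; [compact_scheme] has closed sets instead and needs further
    information. *)
Lemma open_scheme (Y : set X) : open Y ->
  (forall y, Y y -> exists n, interior (K n) y) -> exists S : seq nat -> set X,
  [/\ S [::] = Y, forall s, open (S s), forall s, S s `<=` Y,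
      forall s x, S s x -> exists i, S (rcons s i) x & scheme S].
Proof.
move=> oY YK.
have [O [OP OB]] := tower_locally_compact_base hK.
have oO i : open (O i) by have [n []] := OP i.
(* The condition at level [k] keeps [U] from meeting both [closure (O a)] and
   the complement of [O c], so a branch determines a single point. *)
pose good k (U : set X) := if unpickle k is Some (a, c) then
  closure (O a) `<=` O c -> U `<=` O c \/ U `&` closure (O a) = set0 else True.
pose prev k (s : seq nat) := if k is k'.+1 then O (nth 0%N s k') else Y.
pose S s := [set x | Y x /\ forall k, (k < size s)%N ->
  [/\ O (nth 0%N s k) x, good k (O (nth 0%N s k)) &
      closure (O (nth 0%N s k)) `<=` prev k s]].
pose prevb k (b : nat -> nat) := if k is k'.+1 then O (b k') else Y.
have prevE b m k : (k <= m)%N -> prev k (mkseq b m) = prevb k b.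
  by rewrite /prev /prevb; case: k => // k km; rewrite nth_mkseq.
have SP b m x : S (mkseq b m) x <-> Y x /\ forall k, (k < m)%N ->
    [/\ O (b k) x, good k (O (b k)) & closure (O (b k)) `<=` prevb k b].
  split=> -[Yx h]; split=> // k.
    move=> km; have := h k; rewrite size_mkseq => /(_ km).
    by rewrite nth_mkseq// prevE// ltnW.
  rewrite size_mkseq => km; have := h k km.
  by rewrite nth_mkseq// prevE// ltnW.
have oprev k s : open (prev k s).
  by rewrite /prev; case: k => // k; exact: oO.
have Sprev s x : S s x -> prev (size s) s x.
  move=> [Yx h]; rewrite /prev; case: (size s) h => // k /(_ k (ltnSn k)).
  by case.
(* The closures are nested, so membership in the last set implies membership in all earlier ones;
   this makes [S s] open. *)
have prevS s x y : S s x -> prev (size s) s y -> S s y.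
  move=> [Yx h] py.
  suff pk : forall k, (k <= size s)%N -> prev k s y -> Y y /\
      forall j, (j < k)%N -> O (nth 0%N s j) y.
    have [Yy Oy] := pk _ (leqnn _) py; split=> // k ks.
    by have [? ? ?] := h k ks; split=> //; exact: Oy.
  elim=> [|k IH] ks //= Oy.
  have [_ _ cl] := h k ks.
  have [Yy Oj] := IH (ltnW ks) (cl _ (subset_closure Oy)).
  split=> // j; rewrite ltnS leq_eqVlt => /orP[/eqP ->//|]; exact: Oj.
exists S; split=> //.
- by apply/seteqP; split=> [x []|x Yx].
- move=> s; apply: open_nbhs_sub => x Sx; exists (prev (size s) s); split=> //.
    exact: Sprev.
  by move=> y; exact: prevS Sx.
- by move=> s x [].
- move=> s x Sx; have [n Kx] := YK x Sx.1.
  pose k := size s.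
  (* All subsets of [W] are good at this level: [W] is [O c] if [x] lies in the closure of [O a],
     the complement of that closure if not, and the whole space where the condition is void. *)
  have [W [oW Wx WW]] : exists W, [/\ open W, W x &
      forall U, U `<=` W -> good k U].
    rewrite /good; case: unpickle => [[a c]|]; last first.
      by exists setT; split=> //; exact: openT.
    have [Ox|nOx] := pselect (closure (O a) x).
      have [ac|nac] := pselect (closure (O a) `<=` O c); last first.
        by exists setT; split=> //; exact: openT.
      by exists (O c); split=> //; [exact: ac | move=> U UO _; left].
    exists (~` closure (O a)); split=> //.
      by apply: closed_openC; exact: closed_closure.
    by move=> U UO _; right; apply/seteqP; split=> // z [/UO].
  have [i [Ox clO]] := OB n x (W `&` prev k s) (openI oW (oprev k s))
    (conj Wx (Sprev _ _ Sx)) Kx.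
  have [Yx h] := Sx.
  have prevr j : (j <= k)%N -> prev j (rcons s i) = prev j s.
    by case: j => //= j js; rewrite nth_rcons js.
  exists i; split=> // j; rewrite size_rcons ltnS leq_eqVlt nth_rcons.
  case/orP => [/eqP ->|js]; rewrite ?ltnn ?eqxx.
    split=> //; last by rewrite prevr// => z /clO[].
    by apply: WW => z /subset_closure/clO[].
  by rewrite js prevr ?(ltnW js)//; exact: h.
move=> b Sb0.
have bP k : [/\ O (b k) !=set0, good k (O (b k)) &
    closure (O (b k)) `<=` prevb k b].
  have [x /SP[_ /(_ k (ltnSn k))[Ox g cl]]] := Sb0 k.+1.
  by split=> //; exists x.
pose C k := closure (O (b k)).
have Cdecr k : C k.+1 `<=` C k.
  by apply: subset_trans (@subset_closure _ _); have [_ _] := bP k.+1.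
have cC : compact (C 0%N).
  have [n [_ OK]] := OP (b 0%N).
  apply: (subclosed_compact (@closed_closure _ _) (tower_compact hK n)).
  rewrite [X in _ `<=` X](closure_id (K n)).1; first exact: closureS.
  exact: (tower_closed hK).
have clC k : closed (C k) by exact: closed_closure.
have [|x xC] := compact_decreasing_bigcap cC clC Cdecr.
  by move=> k; have [[x Ox] _ _] := bP k; exists x; exact: subset_closure.
have {}xC k : C k x by exact: xC.
have xO k : O (b k) x by have [_ _ h] := bP k.+1; exact: h (xC _).
have Yx : Y x by have [_ _ h] := bP 0%N; exact: h (xC _).
have Slim := scheme_limit cC clC Cdecr _.
exists x; split=> [m|U oU Ux].
  by apply/SP; split=> // k _; have [_ ? ?] := bP k; split.
have [|k kU] := Slim x _ U oU Ux; last first.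
  exists k.+1; apply: subset_trans kU => y /SP[_ /(_ k (ltnSn k))[Oy _ _]].
  exact: subset_closure.
move=> y yC; apply: contrapT => yx.
have yO k : O (b k) y by have [_ _ h] := bP k.+1; exact: h (yC _).
have [n Kx] := YK x Yx.
(* With the closure of [O c] missing [y] and the closure of [O a] inside [O c], the level coding
   [(a, c)] either stays in [O c] and excludes [y], or avoids [O a] and excludes [x]. *)
have [||c [Ocx clc]] := OB n x (~` [set y]) _ _ Kx.
- by apply: closed_openC; exact: (tower_set1 hK).
- by move=> /esym.
have [a [Oax cla]] := OB n x (O c) (oO c) Ocx Kx.
have [_] := bP (pickle (a, c)); rewrite /good pickleK => /(_ cla) [h|h] _.
  by apply: (clc y) => //; apply: subset_closure; exact/h.
have : (O (b (pickle (a, c))) `&` closure (O a)) x.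
  by split=> //; exact: subset_closure.
by rewrite h.
Qed.

(* The points at which [X] is not locally compact. *)
Definition wild := [set x | forall n, ~ interior (K n) x].

Lemma wildPn x : ~ wild x <-> exists n, interior (K n) x.
Proof.
split=> [/existsNP[n /contrapT]|[n Kx] /(_ n)//]; by exists n.
Qed.

Lemma open_tame : open (~` wild).
Proof.
apply: open_nbhs_sub => x /wildPn[n Kx].
exists (interior (K n)); split=> //; first exact: open_interior.
by move=> y Ky; apply/wildPn; exists n.
Qed.

(** At a wild point a countable neighbourhood base yields points outside [K n] converging to [x],
    against [tower_escape]. *)
Lemma first_countable_tame (x : X) : first_countable_at x -> ~ wild x.
Proof.
move=> [W [xW WU]] wx.
have /choice[v vP] n : exists y, W n y /\ ~ K n y.
  apply: contrapT => nex; apply: (wx n); apply: filterS (xW n) => y Wy.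
  by apply: contrapT => nKy; apply: nex; exists y.
have [U [N [oU Ux UP]]] := tower_escape hK x (fun n => (vP n).2).
have [n nU] := WU U (open_nbhs_nbhs (conj oU Ux)).
apply: (UP (maxn N n) (leq_maxl _ _)).
by apply: (nU _ (leq_maxr N n)); have [] := vP (maxn N n).
Qed.

Lemma tame_second_countable : (forall x, ~ wild x) -> @second_countable X.
Proof.
move=> tame; have [O [OP OB]] := tower_locally_compact_base hK.
exists (range O); first exact: sub_countable (card_image_le _ _) (countableP _).
split=> [_ [i _ <-]|x A]; first by have [n []] := OP i.
rewrite nbhsE => -[U [oU Ux] UA].
have [n Kx] := (wildPn x).1 (tame x).
have [i [Ox OU]] := OB n x U oU Ux Kx.
exists (O i); first by split=> //; exists i.
by move=> y /subset_closure /OU /UA.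
Qed.

End Schemes.

(** * Polish spaces *)

Definition metric_copy (T : Type) : Type := T.
HB.instance Definition _ (T : choiceType) := Choice.on (metric_copy T).

Section SupMetric.
Local Open Scope ring_scope.
Variables (R : realType) (X : topologicalType) (I : Type) (i0 : I).
Variable (phi : I -> X -> R).
Hypothesis phi01 : forall i x, 0 <= phi i x <= 1.
Hypothesis phi_equicontinuous : forall x e, 0 < e -> exists U : set X,
  [/\ open U, U x & forall y i, U y -> `|phi i x - phi i y| <= e].
Hypothesis phi_separates : forall x y, (forall i, phi i x = phi i y) -> x = y.
Hypothesis phi_proper : forall x, exists C : set X, compact C /\
  forall y, (forall i, `|phi i x - phi i y| < 1) -> C y.

Let dist x y := sup (range (fun i => `|phi i x - phi i y|)).

Let phi_le1 i x y : `|phi i x - phi i y| <= 1.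
Proof.
have /andP[x0 x1] := phi01 i x; have /andP[y0 y1] := phi01 i y.
rewrite ler_norml; apply/andP; split; lra.
Qed.

Let le_dist i x y : `|phi i x - phi i y| <= dist x y.
Proof.
apply: ub_le_sup; last by exists i.
by exists 1 => _ [j _ <-]; exact: phi_le1.
Qed.

Let dist_le x y c : (forall i, `|phi i x - phi i y| <= c) -> dist x y <= c.
Proof.
move=> h; apply: ge_sup; first by exists `|phi i0 x - phi i0 y|; exists i0.
by move=> _ [i _ <-].
Qed.

Let dist_ge0 x y : 0 <= dist x y.
Proof. exact: le_trans (normr_ge0 _) (le_dist i0 x y). Qed.

Let distxx x : dist x x = 0.
Proof.
apply/eqP; rewrite eq_le dist_ge0 andbT.
by apply: dist_le => i; rewrite subrr normr0.
Qed.

Let dist_eq0 x y : dist x y = 0 -> x = y.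
Proof.
move=> d0; apply: phi_separates => i; apply/eqP; rewrite -subr_eq0 -normr_eq0.
by rewrite eq_le normr_ge0 andbT -d0 le_dist.
Qed.

Let dist_sym x y : dist x y = dist y x.
Proof.
rewrite /dist.
suff -> : (fun i => `|phi i x - phi i y|) = fun i => `|phi i y - phi i x| by [].
by apply: funext => i; rewrite distrC.
Qed.

Let dist_triangle y x z : dist x z <= dist x y + dist y z.
Proof.
apply: dist_le => i; apply: le_trans (lerD (le_dist i x y) (le_dist i y z)).
exact: ler_distD.
Qed.

(** Equicontinuity makes the metric topology coarser than the given one. Unit balls lie in compact
    sets, which yields both the converse and completeness. *)
Lemma sup_metric_complete :
  exists2 M : metricType R, complete_metric M & homeomorphic X M.
Proof.
pose M : metricType R := HB.pack (metric_copy X)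
  (isMetric.Build R (metric_copy X) distxx dist_eq0 dist_sym dist_triangle).
have MballE (x : M) e : ball x e = [set y | dist x y < e] by [].
have to_cont : continuous (id : X -> M).
  move=> x A /nbhs_ballP[e /= e0 eA].
  have [U [oU Ux UP]] := phi_equicontinuous x (divr_gt0 e0 (ltr0n _ 2)).
  apply: filterS (open_nbhs_nbhs (conj oU Ux)) => y Uy; apply: eA.
  rewrite MballE /=; apply: le_lt_trans (_ : e / 2 < e); last by lra.
  by apply: dist_le => i; exact: UP.
have cl_ball (x : X) c : closed [set y : X | dist x y <= c].
  rewrite -[X in closed X]setCK; apply: open_closedC.
  apply: open_nbhs_sub => y /= /negP; rewrite -ltNge => cy.
  pose e := (dist x y - c) / 2; have e0 : 0 < e by rewrite /e; lra.
  have [U [oU Uy UP]] := phi_equicontinuous y e0.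
  exists U; split=> // z Uz; apply/negP; rewrite -ltNge.
  have yz : dist y z <= e by apply: dist_le => i; exact: UP.
  have := dist_triangle z x y; rewrite (dist_sym z y) /e in yz *; lra.
have proper (x : X) : exists C : set X, compact C /\ forall y, dist x y < 1 -> C y.
  have [C [cC CP]] := phi_proper x; exists C; split=> // y xy.
  by apply: CP => i; apply: le_lt_trans xy.
exists M; last first.
  exists id, id; split=> //.
  move=> x A; rewrite nbhsE => -[U [oU Ux] UA].
  have [C [cC CP]] := proper x.
  (* The shift by 2 keeps the radius below 1, hence the closed ball inside the compact [C]; if no
     [S n] were empty, a common point would be at distance 0 from [x] but outside [U]. *)
  pose S n : set X := [set y | dist x y <= n.+2%:R^-1] `\` U.
  have clS n : closed (S n).
    by apply: closedI; [exact: cl_ball | exact: open_closedC].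
  have [n nU] : exists n, S n = set0.
    apply: contrapT => nS.
    have [|||n|y yS] := @compact_decreasing_bigcap X S.
    - apply: (subclosed_compact _ cC) => // y [/= xy _]; apply: CP.
      by apply: le_lt_trans xy _; rewrite invf_lt1// ltr1n.
    - by [].
    - move=> m y [/= xy nUy]; split=> //=; apply: le_trans xy _.
      by rewrite lef_pV2 ?posrE// ler_nat.
    - by apply: contrapT => /set0P/negP/negPn/eqP Sn; apply: nS; exists n.
    have [n _] : exists2 n, True & ~ S n y; last by apply; exact: yS.
    have [_ nUy] := yS 0%N Logic.I.
    have xy : 0 < dist x y.
      rewrite lt_neqAle dist_ge0 andbT eq_sym; apply/eqP => /dist_eq0 xy.
      by rewrite -xy in nUy.
    have [N] := ltr_add_invr xy; rewrite add0r => Ny.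
    exists N => // -[/= yN _]; move: Ny; apply/negP; rewrite -leNgt.
    by apply: le_trans yN _; rewrite lef_pV2 ?posrE// ler_nat.
  apply/nbhs_ballP; exists n.+2%:R^-1; first by rewrite /= invr_gt0.
  move=> y; rewrite MballE /= => xy; apply: UA; apply: contrapT => nUy.
  have : S n y by split=> //=; exact: ltW.
  by rewrite nU.
(* A Cauchy filter contains a unit ball, hence the compact [C], hence clusters at some [y], to which
   it converges. *)
move=> F PF /cauchyP cF; have [x Fx] := cF 1 ltr01.
have [C [cC CP]] := proper x.
have cC' : compact (C : set M).
  rewrite -[C]image_id; apply: (@continuous_compact X M) => //.
  exact: continuous_subspaceT.
have FC : F C by apply: filterS Fx => y; rewrite MballE; exact: CP.
have [y [Cy Fy]] := cC' F PF FC.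
exists y => A /nbhs_ballP[e /= e0 eA].
have [z Fz] := cF (e / 3) (divr_gt0 e0 (ltr0n _ 3)).
have yball : nbhs y (ball y (e / 3)) by apply: nbhsx_ballx; exact: divr_gt0.
have [w []] := Fy _ _ Fz yball; rewrite !MballE /= => zw yw.
apply: filterS Fz => t; rewrite MballE /= => zt; apply: eA; rewrite MballE /=.
have := dist_triangle w y t; have := dist_triangle z w t.
by rewrite (dist_sym w z); lra.
Qed.

End SupMetric.

Section Polish.
Local Open Scope ring_scope.
Variables (R : realType) (X : topologicalType) (K : nat -> set X).
Hypothesis hK : tower K.

Lemma tower_urysohn (A B : set X) : closed A -> closed B -> A `&` B = set0 ->
  exists f : X -> R, [/\ forall x, 0 <= f x <= 1,
    forall x, A x -> f x = 0, forall x, B x -> f x = 1 &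
    forall x e, 0 < e -> exists U : set X,
      [/\ open U, U x & forall y, U y -> `|f x - f y| <= e]].
Proof.
move=> cA cB AB.
have nX : normal_space X by apply/(@normal_openP R); exact: tower_normal hK.
have /(@uniform_separatorP X R)[f [cf f01 fA fB]] :=
  (@normal_separatorP R X).1 nX A B cA cB AB.
exists f; split.
- by move=> x; have := f01 (f x) (ex_intro2 _ _ x Logic.I erefl); rewrite /= in_itv.
- by move=> x Ax; apply: fA; exists x.
- by move=> x Bx; apply: fB; exists x.
move=> x e e0; have : nbhs x (f @^-1` ball (f x) e) by apply: cf; exact: nbhsx_ballx.
rewrite nbhsE => -[U [oU Ux] UP]; exists U; split=> // y /UP.
by rewrite /= /ball /= => /ltW.
Qed.

Lemma equicontinuous_finite (f : nat -> X -> R) (x : X) N e : 0 < e ->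
  (forall n (x : X) e, 0 < e -> exists U : set X,
      [/\ open U, U x & forall y, U y -> `|f n x - f n y| <= e]) ->
  exists U : set X, [/\ open U, U x &
    forall y n, (n < N)%N -> U y -> `|f n x - f n y| <= e].
Proof.
move=> e0 cf; elim: N => [|N [U [oU Ux UP]]].
  by exists setT; split=> //; exact: openT.
have [V [oV Vx VP]] := cf N x e e0.
exists (U `&` V); split=> //; first exact: openI.
by move=> y n; rewrite ltnS leq_eqVlt => /orP[/eqP -> [_ /VP]|nN [Uy _]]//; exact: UP.
Qed.

(** The increasing interiors cover the compact [K n], so one of them contains it; iterating picks a
    subsequence of [K]. *)
Lemma tame_exhaustion : (forall x, ~ wild K x) ->
  exists L : nat -> set X, [/\ forall n, compact (L n) /\ closed (L n),
    forall n, L n `<=` interior (L n.+1) & forall x, exists n, L n x].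
Proof.
move=> tame.
have intK m n : (m <= n)%N -> interior (K m) `<=` interior (K n).
  by move=> mn; apply: interiorS; exact: (tower_incr hK).
have /choice[f fP] n : exists m, (n < m)%N /\ K n `<=` interior (K m).
  have [||||m Km] := @compact_increasing_cover _ (K n) (fun m => interior (K m)).
  - exact: (tower_compact hK).
  - by move=> m; exact: open_interior.
  - by move=> m; exact: intK.
  - by move=> x _; have [m Kx] := (wildPn K x).1 (tame x); exists m.
  exists (maxn m n.+1); split; first exact: leq_maxr.
  by apply: subset_trans Km _; apply: intK; exact: leq_maxl.
pose k := fix k n := if n is n'.+1 then f (k n') else 0%N.
have kn n : (n <= k n)%N.
  by elim: n => [//|n IH] /=; apply: leq_ltn_trans IH _; have [] := fP (k n).
exists (fun n => K (k n)); split.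
- by move=> n; split; [exact: (tower_compact hK) | exact: (tower_closed hK)].
- by move=> n /=; have [] := fP (k n).
- move=> x; have [n Kx] := tower_cover hK x; exists n.
  exact: (tower_incr hK (kn n)) Kx.
Qed.

Lemma tame_polish : (forall x, ~ wild K x) -> polish R X.
Proof.
move=> tame; split.
  have [B cB [Bo Bb]] := tame_second_countable hK tame.
  have /choice[c cP] (U : set X) : exists c : set X,
      countable c /\ (U !=set0 -> c `&` U !=set0).
    have [[x Ux]|nU] := pselect (U !=set0).
      by exists [set x]; split; [exact: countable1 | exists x].
    by exists set0; split=> // [] [x Ux]; case: nU; exists x.
  exists (\bigcup_(U in B) c U).
    by apply: bigcup_countable => // U _; have [] := cP U.
  move=> U [x Ux] oU; have [W [BW Wx] WU] := Bb x U (open_nbhs_nbhs (conj oU Ux)).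
  have [y [cy Wy]] := (cP W).2 (ex_intro _ x Wx).
  by exists y; split; [exact: WU | exists W].
have [O [OP OB]] := tower_locally_compact_base hK.
have [L [cL Lint Lcov]] := tame_exhaustion tame.
have Lincr m n : (m <= n)%N -> L m `<=` L n.
  elim: n => [|n IH]; first by rewrite leqn0 => /eqP ->.
  rewrite leq_eqVlt => /orP[/eqP ->//|/IH h]; apply: subset_trans h _.
  by apply: subset_trans (Lint n) _; exact: interior_subset.
(* [u n] rises from 0 on [L n] to 1 off the interior of [L n.+1], so a point at distance less than 1
   from a point of [L n] stays in the compact [L n.+1]. *)
have /choice[u uP] n : exists f : X -> R, [/\ forall x, 0 <= f x <= 1,
    forall x, L n x -> f x = 0, forall x, (~` interior (L n.+1)) x -> f x = 1 &
    forall x e, 0 < e -> exists U : set X,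
      [/\ open U, U x & forall y, U y -> `|f x - f y| <= e]].
  apply: tower_urysohn; first by have [] := cL n.
    by apply: open_closedC; exact: open_interior.
  by apply/seteqP; split=> // x [/Lint].
(* For a code of [(a, c)] with the closure of [O a] inside [O c], [v j] separates [O a] from the
   complement of [O c]; such functions separate points. *)
have /choice[v vP] j : exists f : X -> R, [/\ forall x, 0 <= f x <= 1,
    forall x e, 0 < e -> exists U : set X,
      [/\ open U, U x & forall y, U y -> `|f x - f y| <= e] &
    forall a c, unpickle j = Some (a, c) -> closure (O a) `<=` O c ->
      (forall x, O a x -> f x = 0) /\ (forall x, ~ O c x -> f x = 1)].
  have [A [B [cA cB AB ABP]]] : exists A B : set X, [/\ closed A, closed B,
      A `&` B = set0 & forall a c, unpickle j = Some (a, c) ->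
      closure (O a) `<=` O c -> O a `<=` A /\ ~` O c `<=` B].
    case: (unpickle j) => [[a c]|]; last first.
      exists set0, set0; split=> //; [exact: closed0 | exact: closed0 |].
      by rewrite setI0.
    have [ac|nac] := pselect (closure (O a) `<=` O c); last first.
      exists set0, set0; split; [exact: closed0 | exact: closed0 | by rewrite setI0 |].
      by move=> a' c' [<- <-].
    exists (closure (O a)), (~` O c); split.
    - exact: closed_closure.
    - by apply: open_closedC; have [n []] := OP c.
    - by apply/seteqP; split=> // x [/ac].
    - by move=> a' c' [<- <-] _; split=> //; exact: subset_closure.
  have [f [f01 fA fB cf]] := tower_urysohn cA cB AB.
  exists f; split=> // a c /ABP /[apply] -[aA cB'].
  by split=> x; [move/aA/fA | move/cB'/fB].
(* The factor makes all but finitely many of the [v j] small, for equicontinuity. The [u n] need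
   none: near a point of [L N] those with [n > N] vanish. *)
pose phi (i : nat + nat) x := match i with
  | inl n => u n x
  | inr j => v j x / j.+1%:R
  end.
have scale j : 0 < (j.+1%:R^-1 : R) <= 1.
  by rewrite invr_gt0 ltr0n /= invf_le1// ler1n.
apply: (@sup_metric_complete R X _ (inl 0%N) phi).
- move=> [n|j] x /=; first by have [h _ _ _] := uP n; exact: h.
  have [/(_ x)/andP[v0 v1] _ _] := vP j; have /andP[j0 j1] := scale j.
  apply/andP; split; first by apply: mulr_ge0 => //; exact: ltW.
  by apply: le_trans (ler_pM v0 (ltW j0) v1 j1) _; rewrite mulr1.
- move=> x e e0; have [N Lx] := Lcov x.
  have [U [oU Ux UP]] := equicontinuous_finite x N.+1 e0
    (fun n => let: And4 _ _ _ h := uP n in h).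
  have [J] := ltr_add_invr e0; rewrite add0r => Je.
  have [V [oV Vx VP]] := equicontinuous_finite x J e0
    (fun j => let: And3 _ h _ := vP j in h).
  exists (U `&` V `&` interior (L N.+1)); split.
  + by apply: openI; [exact: openI | exact: open_interior].
  + by split; [split | exact: Lint].
  move=> y [n|j] [[Uy Vy] Ly] /=.
    have [nN|Nn] := ltnP n N.+1; first exact: UP.
    have [_ h _ _] := uP n; rewrite !h ?subrr ?normr0 ?(ltW e0)//.
      apply: (Lincr N.+1) => //; exact: interior_subset.
    by apply: (Lincr N) => //; exact: ltnW.
  have /andP[j0 j1] := scale j; rewrite -mulrBl normrM (ger0_norm (ltW j0)).
  have [jJ|Jj] := ltnP j J.
    apply: le_trans (VP y j jJ Vy); rewrite -[leRHS]mulr1.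
    by apply: ler_wpM2l.
  have [v01 _ _] := vP j.
  have /andP[vx0 vx1] := v01 x; have /andP[vy0 vy1] := v01 y.
  have le1 : `|v j x - v j y| <= 1 by rewrite ler_norml; apply/andP; split; lra.
  apply: le_trans (ltW Je); apply: le_trans (ler_pM _ (ltW j0) le1 (lexx _)) _ => //.
  by rewrite mul1r lef_pV2 ?posrE// ler_nat.
- move=> x y xy; apply: contrapT => nxy.
  have [n Kx] := (wildPn K x).1 (tame x).
  have [||c [Ocx clc]] := OB n x (~` [set y]) _ _ Kx.
  + by apply: closed_openC; exact: (tower_set1 hK).
  + exact: nxy.
  have oOc : open (O c) by have [m []] := OP c.
  have [a [Oax cla]] := OB n x (O c) oOc Ocx Kx.
  have [_ _ /(_ a c (pickleK _) cla)[v0 v1]] := vP (pickle (a, c)).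
  have := xy (inr (pickle (a, c))); rewrite /= v0// v1; last first.
    by move=> Ocy; apply: (clc y) => //; exact: subset_closure.
  move=> /eqP; rewrite mul0r mul1r eq_sym; apply/negP.
  by have /andP[+ _] := scale (pickle (a, c)); case: ltgtP.
- move=> x; have [N Lx] := Lcov x; exists (L N.+1); split.
    by have [] := cL N.+1.
  move=> y /(_ (inl N)) /= xy; apply: interior_subset; apply: contrapT => nLy.
  have [_ u0 u1 _] := uP N; move: xy.
  by rewrite u0// u1// sub0r normrN normr1 ltxx.
Qed.

Lemma polish_first_countable (x : X) : polish R X -> first_countable_at x.
Proof.
move=> [_ [M _ [f [g [cf cg fK gK]]]]].
exists (fun n => f @^-1` ball (f x) n.+1%:R^-1); split.
  by move=> n; apply: cf; apply: nbhsx_ballx; rewrite invr_gt0.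
move=> U xU; have /nbhs_ballP[e /= e0 eU] : nbhs (f x) (g @^-1` U).
  by apply: cg; rewrite fK.
have [n] := ltr_add_invr e0; rewrite add0r => ne; exists n => m nm y /= fxy.
rewrite -(fK y); apply: eU; apply: le_ball fxy; apply: le_trans (ltW ne).
by rewrite lef_pV2 ?posrE// ler_nat.
Qed.

End Polish.

(** * Continuity and reducibility on Baire space *)

Definition agree k (p q : baire) := forall i, (i < k)%N -> p i = q i.

Lemma agree_refl k p : agree k p p. Proof. by []. Qed.

Lemma agree_sym k p q : agree k p q -> agree k q p.
Proof. by move=> pq i /pq. Qed.

Lemma agree_trans k p q r : agree k p q -> agree k q r -> agree k p r.
Proof. by move=> pq qr i ik; rewrite pq// qr. Qed.

Lemma agree_leq m n p q : (m <= n)%N -> agree n p q -> agree m p q.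
Proof. by move=> mn pq i im; apply: pq; exact: leq_trans mn. Qed.

Lemma agree_mkseq k p q : agree k p q <-> mkseq p k = mkseq q k.
Proof. by split=> /mkseq_eqP. Qed.

Lemma agree_bpair k p s p' s' :
  agree k.*2 (bpair p s) (bpair p' s') -> agree k p p' /\ agree k s s'.
Proof.
move=> h; split=> i ik.
  have := h i.*2; rewrite /bpair odd_double doubleK; apply.
  by rewrite ltn_double.
have := h i.*2.+1; rewrite /bpair /= odd_double /= uphalf_double; apply.
by rewrite -doubleS leq_double.
Qed.

Lemma bpair_agree k p s p' s' :
  agree k p p' -> agree k s s' -> agree k (bpair p s) (bpair p' s').
Proof.
move=> pp ss i ik; have ik2 : (i./2 < k)%N.
  by apply: leq_ltn_trans ik; rewrite -divn2 leq_div.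
by rewrite /bpair; case: ifP => _; [exact: ss | exact: pp].
Qed.

Lemma bpair_inj p s p' s' : bpair p s = bpair p' s' -> p = p' /\ s = s'.
Proof.
move=> e; split; apply: funext => i.
  have := congr1 (@^~ i.*2) e.
  by rewrite /bpair odd_double doubleK.
have := congr1 (@^~ i.*2.+1) e.
by rewrite /bpair /= odd_double /= uphalf_double.
Qed.

Lemma pcontinuousP (Y : topologicalType) (F : partial_map baire Y) :
  pcontinuous F <-> forall p y, F p y -> forall U, open U -> U y ->
    exists k, forall p' y', F p' y' -> agree k p p' -> U y'.
Proof.
split=> [cF p y Fpy U oU Uy|cF V oV].
  have [W oW WP] := cF U oU.
  have [k kW] := nbhs_cyl (open_nbhs_nbhs (conj oW ((WP _ _ Fpy).2 Uy))).
  exists k => p' y' Fpy' pp'; apply/(WP _ _ Fpy'); apply: kW.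
  exact/esym/agree_mkseq.
exists [set p | exists k, forall p' y', F p' y' -> agree k p p' -> V y'].
  apply: open_cyl => p [k kV]; exists k => q /agree_mkseq qp.
  exists k => p' y' Fpy' qp'; apply: kV Fpy' _.
  by apply: agree_trans qp'; exact: agree_sym.
move=> p y Fpy; split=> [[k /(_ p y Fpy)]|Vy]; first by apply.
exact: cF Fpy V oV Vy.
Qed.

Lemma pcontinuous_baireP (F : partial_map baire baire) :
  pcontinuous F <-> forall p q, F p q -> forall n,
    exists k, forall p' q', F p' q' -> agree k p p' -> agree n q q'.
Proof.
rewrite pcontinuousP; split=> cF p q Fpq.
  move=> n; have [||k kP] := cF p q Fpq [set q' | agree n q q'].
  - apply: open_cyl => r /= qr; exists n => s /agree_mkseq sr.
    by apply: agree_trans qr _; exact: agree_sym.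
  - by [].
  by exists k => p' q' Fpq' /kP; exact.
move=> U oU Uq; have [n nU] := nbhs_cyl (open_nbhs_nbhs (conj oU Uq)).
have [k kP] := cF p q Fpq n; exists k => p' q' Fpq' pp'; apply: nU.
exact/esym/agree_mkseq/(kP p').
Qed.

Lemma agree_uniform (T : Type) (D : set baire) (h : baire -> nat -> T) :
  (forall p n, D p -> exists k, forall p', D p' -> agree k p p' -> h p n = h p' n) ->
  forall p n, D p -> exists k, forall p', D p' -> agree k p p' ->
    forall i, (i < n)%N -> h p i = h p' i.
Proof.
move=> ch p n Dp; elim: n => [|n [k kP]]; first by exists 0%N.
have [l lP] := ch p n Dp; exists (maxn k l) => p' Dp' pp' i.
rewrite ltnS leq_eqVlt => /orP[/eqP ->|].
  by apply: lP Dp' _; apply: agree_leq pp'; exact: leq_maxr.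
by apply: kP Dp' _ _; apply: agree_leq pp'; exact: leq_maxl.
Qed.

Lemma fun_map_functional (T : Type) (D : set baire) (h : baire -> T) p x y :
  D p /\ x = h p -> D p /\ y = h p -> x = y.
Proof. by move=> [_ ->] [_ ->]. Qed.

Definition fun_map (T : Type) (D : set baire) (h : baire -> T) :=
  PartialMap (@fun_map_functional T D h).

Definition locally_determined (D : set baire) (h : baire -> baire) :=
  forall p n, D p -> exists k, forall p', D p' -> agree k p p' -> h p n = h p' n.

Lemma fun_map_continuous D h : locally_determined D h -> pcontinuous (fun_map D h).
Proof.
move=> ch; apply/pcontinuous_baireP => p _ [Dp ->] n.
have [k kP] := agree_uniform ch n Dp.
by exists k => p' _ [Dp' ->] /(kP _ Dp').
Qed.

(** The value top shows in one nonzero output entry, which [eta] computes from finitely many entries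
    of [a] and [q]. *)
Lemma open_eval (Z : repspace) a (f : open_space Z) q z :
  delta (open_space Z) a f -> delta Z q z -> sval f z = true ->
  exists k, forall a' (f' : open_space Z) q' z', delta (open_space Z) a' f' ->
    delta Z q' z' -> agree k a a' -> agree k q q' -> sval f' z' = true.
Proof.
move=> af qz fz; have [s qs sz] := cfun_name_apply af qz.
have [m sm] : exists m, s m <> 0%N.
  apply: contrapT => /forallNP s0; have /sz : forall n, s n = 0%N.
    by move=> n; apply: contrapT; exact: s0.
  by rewrite fz.
have [k ak lk] := qs m.
pose c j := CodeSeq.code (m :: mkseq q j).
(* [N] exceeds every position of [a] consulted up to the deciding one, and covers the part of [q]
   that occurs in these positions. *)
pose N := maxn k (\max_(j < k.+1) (c j)).+1.
have cN j : (j <= k)%N -> (c j < N)%N.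
  move=> jk; rewrite leq_max; apply/orP; right.
  by rewrite ltnS (leq_bigmax (Ordinal (jk : (j < k.+1)%N))).
exists N => a' f' q' z' af' qz' aa' qq'.
have [s' qs' sz'] := cfun_name_apply af' qz'.
have qqj j : (j <= k)%N -> mkseq q' j = mkseq q j.
  move=> jk; apply/esym/agree_mkseq; apply: agree_leq qq'.
  by rewrite leq_max jk.
apply/negP => /negP/negbTE/sz'/(_ m) s'm.
have [k' ak' lk'] := qs' m; move: ak'; rewrite s'm.
case: (ltngtP k' k) => [kk'|kk'|->].
- by rewrite qqj ?(ltnW kk')// -aa' ?cN ?(ltnW kk')// lk.
- by have := lk' _ kk'; rewrite qqj// -aa' ?cN// ak.
- by rewrite qqj// -aa' ?cN// ak => -[].
Qed.

(** Output entry [n] of the section tests whether the first [n] entries of both names already force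
    the value top. *)
Lemma open_curry (Z : repspace) (D : set baire) (f : baire -> Z -> bool) :
  (forall r q z, D r -> delta Z q z -> f r z = true ->
    exists k, forall r' q' z', D r' -> delta Z q' z' -> agree k r r' ->
      agree k q q' -> f r' z' = true) ->
  exists2 H : baire -> baire, locally_determined setT H &
    forall r, D r -> realizes (eta (H r)) (@single Z sierpinski (f r)).
Proof.
move=> of_.
pose v r n w := `[< forall r' q' z', D r' -> delta Z q' z' -> agree n r r' ->
  mkseq q' n = w -> f r' z' = true >].
(* Only words of length [n] get a nonzero entry, so [eta] reads exactly [n] entries of the argument;
   the successor is the shift built into [eta_graph]. *)
pose H (r : baire) : baire := fun c => if CodeSeq.decode c is n :: w then
  (if size w == n then (v r n w).+1 else 0%N) else 0%N.
exists H => [r c _|r Dr q z qz _].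
  exists (head 0%N (CodeSeq.decode c)) => r' _ rr'; rewrite /H.
  case: (CodeSeq.decode c) rr' => //= n w rr'.
  case: ifP => // _; congr ((nat_of_bool `[< _ >]).+1).
  apply/propext; split=> h r'' q' z' Dr'' qz' rr''; apply: h => //.
    exact: agree_trans rr''.
  by apply: agree_trans rr''; exact: agree_sym.
exists (fun n => nat_of_bool (v r n (mkseq q n))), (f r z); split=> //.
  move=> n; exists n => [|j jn]; rewrite /H CodeSeq.codeK size_mkseq ?eqxx//.
  by rewrite (ltn_eqF jn).
split=> [frz n|h].
  by rewrite /v; case: asboolP => // /(_ r q z Dr qz (@agree_refl _ _) erefl); rewrite frz.
apply/negP => /(of_ r q z Dr qz)[k kP].
have := h k; rewrite /v; case: asboolP => // -[] r' q' z' Dr' qz' rr'.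
by move=> /esym/agree_mkseq qq'; exact: kP qz' _ _.
Qed.

(** * Continuous selection of branches *)

Section Branch.
Variables (D : set baire) (Q : baire -> seq nat -> Prop).
Hypothesis Qopen : forall t s, D t -> Q t s ->
  exists k, forall t', D t' -> agree k t t' -> Q t' s.
Hypothesis Q0 : forall t, D t -> Q t [::].
Hypothesis QS : forall t s, D t -> Q t s -> exists i, Q t (rcons s i).

Let R w s i := forall t, D t -> mkseq t (size w) = w -> Q t (rcons s i).
Let P t s m := `[< exists i, R (mkseq t m) s i >].

Lemma branch_step_ex t s : D t /\ Q t s -> exists m, P t s m.
Proof.
move=> [Dt Qts]; have [i Qi] := QS Dt Qts; have [k kP] := Qopen Dt Qi.
exists k; apply/asboolP; exists i => t' Dt'; rewrite size_mkseq => tt'.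
by apply: kP => //; exact/agree_mkseq/esym.
Qed.

(** The chosen entry depends only on [s] and on the shortest prefix of [t] that guarantees some
    extension of [s], hence is locally constant; 0 is a default off the domain. *)
Let next t s : nat := if pselect (D t /\ Q t s) is left h then
  xget 0%N [set i | R (mkseq t (ex_minn (branch_step_ex h))) s i] else 0%N.

Let nextP t s : D t -> Q t s -> Q t (rcons s (next t s)).
Proof.
move=> Dt Qts; rewrite /next; case: pselect => [h|[]//].
case: ex_minnP => m /asboolP[i Ri] _.
have /(_ t Dt) : R (mkseq t m) s (xget 0%N [set i | R (mkseq t m) s i]).
  exact: (@xgetPex _ 0%N [set i | R (mkseq t m) s i] (ex_intro _ i Ri)).
by rewrite size_mkseq; exact.
Qed.

Let next_local t s : D t -> Q t s ->
  exists k, forall t', D t' -> agree k t t' -> next t s = next t' s.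
Proof.
move=> Dt Qts; have [k0 k0P] := Qopen Dt Qts.
have [m mP mmin] := ex_minnP (branch_step_ex (conj Dt Qts)).
exists (maxn k0 m) => t' Dt' tt'.
have Qts' : Q t' s by apply: k0P => //; apply: agree_leq tt'; exact: leq_maxl.
have tt'm : agree m t t' by apply: agree_leq tt'; exact: leq_maxr.
rewrite /next; case: pselect => [h|[]//]; case: pselect => [h'|[]//].
case: ex_minnP => n Pn nmin; case: ex_minnP => n' Pn' nmin'.
have nm : n = m by apply/eqP; rewrite eqn_leq nmin// mmin.
have n'n : n' = n.
  have mm j : (j <= m)%N -> mkseq t j = mkseq t' j.
    by move=> jm; apply/agree_mkseq; exact: agree_leq tt'm.
  have n'm : (n' <= m)%N by apply: nmin'; rewrite /P -mm.
  apply/eqP; rewrite eqn_leq nm n'm /=; apply: mmin.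
  by move: Pn'; rewrite /P mm.
by rewrite n'n nm; move/agree_mkseq: tt'm => ->.
Qed.

(** The branch may depend on [t] itself and not only on what [t] names, which is what makes a
    continuous choice possible. *)
Lemma branch_selection : exists2 b : baire -> baire, locally_determined D b &
  forall t n, D t -> Q t (mkseq (b t) n).
Proof.
pose pre := fix pre t n := if n is m.+1 then rcons (pre t m) (next t (pre t m))
  else [::].
have preP t n : D t -> Q t (pre t n).
  by move=> Dt; elim: n => [|n IH] /=; [exact: Q0 | exact: nextP].
pose b t : baire := fun n => next t (pre t n).
have preE t n : mkseq (b t) n = pre t n.
  by elim: n => [//|n IH]; rewrite mkseqS IH.
exists b; last by move=> t n Dt; rewrite preE; exact: preP.
have pre_local t n : D t ->
    exists k, forall t', D t' -> agree k t t' -> pre t n = pre t' n.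
  move=> Dt; elim: n => [|n [k kP]]; first by exists 0%N.
  have [l lP] := next_local Dt (preP t n Dt).
  exists (maxn k l) => t' Dt' tt' /=.
  rewrite -(kP t')//; last by apply: agree_leq tt'; exact: leq_maxl.
  by rewrite (lP t')//; apply: agree_leq tt'; exact: leq_maxr.
move=> t n Dt; have [k kP] := pre_local t n Dt.
have [l lP] := next_local Dt (preP t n Dt).
exists (maxn k l) => t' Dt' tt'; rewrite /b.
rewrite -(kP t')//; last by apply: agree_leq tt'; exact: leq_maxl.
by rewrite (lP t')//; apply: agree_leq tt'; exact: leq_maxr.
Qed.

End Branch.

Lemma nat_selection (D : set baire) (P : baire -> nat -> Prop) :
  (forall t, D t -> exists n k, forall t', D t' -> agree k t t' -> P t' n) ->
  exists2 F : partial_map baire baire, pcontinuous F &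
    forall t, D t -> exists2 q, F t q & P t (q 0%N).
Proof.
move=> hP.
pose Q t s := s = [::] \/ exists n s', s = n :: s' /\
  exists k, forall t', D t' -> agree k t t' -> P t' n.
have [|||b cb bQ] := @branch_selection D Q.
- move=> t s Dt [->|[n [s' [-> [k kP]]]]]; first by exists 0%N => *; left.
  exists k => t' Dt' tt'; right; exists n, s'; split=> //; exists k => t'' Dt'' tt''.
  by apply: kP => //; exact: agree_trans tt''.
- by move=> t _; left.
- move=> t s Dt [->|[n [s' [-> h]]]].
    have [n [k kP]] := hP t Dt; exists n; right; exists n, [::].
    by split=> //; exists k.
  by exists 0%N; right; exists n, (rcons s' 0%N).
exists (fun_map D b); first exact: fun_map_continuous.
move=> t Dt; exists (b t) => //.
by have [//|[n [s' [[<- _] [k]]]]] := bQ t 1%N Dt; exact.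
Qed.

(** Trades the quantifier over realizers of [g] for one over the solutions of a single instance. *)
Lemma weihrauch_leP (X Y Z W : repspace) (f : mfun X Y) (g : mfun Z W) :
  weihrauch_le f g <-> exists H K : partial_map baire baire,
    [/\ pcontinuous H, pcontinuous K & forall p x, delta X p x -> mdom f x ->
      exists q z, [/\ H p q, delta Z q z, mdom g z & forall s w, delta W s w ->
        g z w -> exists r y, [/\ K (bpair p s) r, delta Y r y & f x y]]].
Proof.
split=> -[H [K [cH cK HK]]]; exists H, K; split=> //; last first.
  move=> G Gg p x px fx; have [q [z [Hq qz gz h]]] := HK p x px fx.
  have [s [w [Gs sw gw]]] := Gg q z qz gz.
  have [r [y [Kr ry fy]]] := h s w sw gw.
  by exists r, y; split=> //; exists q, s.
move=> p x px fx.
pose good q := exists z, delta Z q z /\ mdom g z.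
pose sol q s := forall z, delta Z q z -> mdom g z -> exists w, delta W s w /\ g z w.
have /choice[g0 g0P] q : exists s, sol q s.
  have [[z [qz gz]]|nq] := pselect (good q); last first.
    by exists (fun=> 0%N) => z qz gz; case: nq; exists z.
  have [w gw] := gz; have [s sw] := name_of_onto (delta W) w.
  by exists s => z' qz'; rewrite (graph_functional qz' qz) => _; exists w.
pose mk (h : baire -> baire) := fun_map good h.
have mkP h : (forall q, sol q (h q)) -> realizes (mk h) g.
  move=> hh q z qz gz; have [w [sw gw]] := hh q z qz gz.
  by exists (h q), w; split=> //; split=> //; exists z.
have [r0 [y0 [[q [s [Hq [[z [qz gz]] _] _]]] _ _]]] := HK _ (mkP _ g0P) p x px fx.
exists q, z; split=> // s' w s'w gw.
(* Realizers need not be continuous, so [g0] can be altered at [q] alone to return the given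
   [s']. *)
pose h q' := if pselect (q' = q) is left _ then s' else g0 q'.
have hP q' : sol q' (h q').
  rewrite /h; case: pselect => [->|_]; last exact: g0P.
  by move=> z' qz' _; rewrite (graph_functional qz' qz); exists w.
have [r [y [[q' [s'' [Hq' [_ s''E] Kr]]] ry fy]]] := HK _ (mkP _ hP) p x px fx.
exists r, y; split=> //; move: Kr.
rewrite s''E (graph_functional Hq' Hq) /h.
by case: pselect.
Qed.

(** * Names of points, open sets and overt sets *)

Section Names.
Variables (X : topologicalType) (K : nat -> set X) (d : representation X).
Hypotheses (hK : tower K) (hd : admissible d).
Let XX := RepSpace d.

Lemma name_continuous p x (U : set X) : d p x -> open U -> U x ->
  exists k, forall p' x', d p' x' -> agree k p p' -> U x'.
Proof. by move=> px; have /pcontinuousP/(_ p x px U) := hd.1. Qed.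

Lemma open_rep_open (U : set X) : open U -> @rep_open XX U.
Proof.
move=> oU.
pose h p : baire :=
  fun n => nat_of_bool `[< forall p' x', d p' x' -> agree n p p' -> U x' >].
exists (fun_map setT h).
  apply: fun_map_continuous => p n _; exists n => p' _ pp'.
  rewrite /h; congr (nat_of_bool `[< _ >]); apply/propext.
  split=> hU p'' x' px' pp''; apply: (hU p'' x' px').
    exact: agree_trans pp' pp''.
  by apply: agree_trans pp''; exact: agree_sym.
move=> p x px _; exists (h p), (char U x); split=> //.
split=> [/negbT/asboolPn nU n|h0].
  by rewrite /h; case: asboolP => // /(_ p x px (@agree_refl _ _)).
apply/negbTE/asboolPn => Ux; have [k kU] := name_continuous px oU Ux.
by have := h0 k; rewrite /h; case: asboolP.
Qed.

(** The zero sequence [z] and the unit sequences [e j] form a convergent sequence in Baire space;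
    admissibility lifts the continuous map sending them to [x] and [u j]. *)
Lemma convergent_names (u : nat -> X) (x : X) : u @ \oo --> x ->
  exists q s, [/\ d q x, forall j, d (s j) (u j) &
    forall k, exists J, forall j, (J <= j)%N -> agree k q (s j)].
Proof.
move=> ux.
pose z : baire := fun=> 0%N.
pose e j : baire := fun i => nat_of_bool (i == j).
pose R (p : baire) y := (p = z /\ y = x) \/ exists2 j, p = e j & y = u j.
have ez j : e j <> z by move/(congr1 (@^~ j)); rewrite /e eqxx.
have eI i j : e i = e j -> i = j.
  by move/(congr1 (@^~ i)); rewrite /e eqxx; case: eqP.
have RF p y y' : R p y -> R p y' -> y = y'.
  move=> [[-> ->]|[j -> ->]] [[pz ->]|[j' pe ->]] //.
  - by case: (ez j').
  - by case: (ez j).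
  - by rewrite (eI _ _ pe).
have cR : pcontinuous (PartialMap RF).
  apply/pcontinuousP => p y [[-> ->]|[j -> ->]] U oU Uy; last first.
    exists j.+1 => p' y' [[-> _]|[j' -> ->]] pp'.
      by have := pp' j (ltnSn j); rewrite /e eqxx.
    have := pp' j (ltnSn j); rewrite /e eqxx.
    by case: eqP => // <-.
  have [N _ NU] := ux U (open_nbhs_nbhs (conj oU Uy)).
  exists N => p' y' [[_ ->]//|[j -> ->]] zp.
  apply: NU => /=; rewrite leqNgt; apply/negP => jN.
  by have := zp j jN; rewrite /e eqxx.
have [G cG GP] := hd.2 _ cR.
have [|q Gq qx] := (GP z x).1; first by left.
have /choice[s sP] j : exists q', G (e j) q' /\ d q' (u j).
  by have [|q' ? ?] := (GP (e j) (u j)).1; [right; exists j | exists q'].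
exists q, s; split=> //; first by move=> j; have [] := sP j.
move=> k; have /pcontinuous_baireP := cG => /(_ z q Gq k)[J JP].
exists J => j Jj; apply: (JP (e j)); first by have [] := sP j.
move=> i iJ; rewrite /e; case: eqP => // ij.
by move: iJ; rewrite ij ltnNge Jj.
Qed.

(** Within a single [K n] the countable base makes closure points limits of sequences, even if [X]
    is not Fréchet-Urysohn. *)
Lemma tower_closure_seq n (M : set X) (x : X) : closure (K n `&` M) x ->
  exists2 u : nat -> X, (forall i, M (u i)) & u @ \oo --> x.
Proof.
move=> clx; have [V [oV VP]] := tower_base hK n.
have Kx : K n x.
  rewrite (closure_id (K n)).1; last exact: (tower_closed hK).
  by apply: closureS clx => ? [].
pose W m := [set y | forall i, (i < m)%N -> V i x -> V i y].
have Wx m : nbhs x (W m) by exact: countable_nbhs.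
have /choice[u uP] m : exists y, (K n `&` M) y /\ W m y.
  by have [y [? ?]] := clx _ (Wx m); exists y.
exists u; first by move=> i; have [[]] := uP i.
move=> U; rewrite nbhsE => -[U' [oU' Ux] UU'].
have [i [Vx VU]] := VP x U' oU' Ux Kx.
exists i.+1 => //= m im; apply/UU'/VU.
by have [[Ku _] Wu] := uP m; split=> //; exact: Wu.
Qed.

(** If [U] is not open, a point of [U] is a limit of points outside it; along convergent names a
    realizer cannot withdraw the nonzero entry it outputs at the limit. *)
Lemma rep_open_open (U : set X) : @rep_open XX U -> open U.
Proof.
move=> [F cF FU]; apply: (tower_open hK) => n x Ux Kx; apply: contrapT => nex.
have [|u uU ux] := @tower_closure_seq n (~` U) x.
  move=> B; rewrite nbhsE => -[V [oV Vx] VB]; apply: contrapT => nB.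
  apply: nex; exists V; split=> // y [Ky Vy]; apply: contrapT => nUy.
  by apply: nB; exists y; split; [|exact: VB].
have [q [s [qx su qs]]] := convergent_names ux.
have [|r [b [Fr rb bU]]] := FU q x qx; first by exists (char U x).
have bT : b = true by rewrite [b]bU; apply/asboolP.
have [m rm] : exists m, r m <> 0%N.
  apply: contrapT => /forallNP r0; have /rb : forall n, r n = 0%N.
    by move=> i; apply: contrapT; exact: r0.
  by rewrite bT.
have /pcontinuous_baireP := cF => /(_ q r Fr m.+1)[k kP].
have [J JP] := qs k.
have [|r' [b' [Fr' rb' bU']]] := FU (s J) (u J) (su J).
  by exists (char U (u J)).
have /rb'/(_ m) r'm : b' = false by rewrite [b']bU'; apply/asboolPn/uU.
by apply: rm; rewrite (kP _ _ Fr' (JP J (leqnn J)) m (ltnSn m)).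
Qed.

Lemma rep_closed_closed (A : set X) : @rep_closed XX A -> closed A.
Proof. by move=> /rep_open_open/open_closedC; rewrite setCK. Qed.

Lemma closed_rep_closed (A : set X) : closed A -> @rep_closed XX A.
Proof. by move=> cA; apply: open_rep_open; exact: closed_openC. Qed.

(** Otherwise arguments converging to [p] have values [v n] outside [K n], against
    [tower_escape]. *)
Lemma convergent_bounded (phi : partial_map baire X) p x : pcontinuous phi ->
  phi p x -> exists n k, forall p' x', phi p' x' -> agree k p p' -> K n x'.
Proof.
move=> cphi px; apply: contrapT => nex.
have /choice[v vP] n : exists y, ~ K n y /\ exists2 p', phi p' y & agree n p p'.
  apply: contrapT => nv; apply: nex; exists n, n => p' x' px' pp'.
  by apply: contrapT => nK; apply: nv; exists x'; split=> //; exists p'.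
have [U [N [oU Ux UP]]] := tower_escape hK x (fun n => (vP n).1).
have /pcontinuousP/(_ p x px U oU Ux)[k kU] := cphi.
apply: (UP (maxn N k) (leq_maxl _ _)).
have [_ [p' px' pp']] := vP (maxn N k); apply: kU px' _.
by apply: agree_leq pp'; exact: leq_maxr.
Qed.

Lemma name_bounded p x : d p x ->
  exists n k, forall p' x', d p' x' -> agree k p p' -> K n x'.
Proof. exact: convergent_bounded hd.1. Qed.

Lemma convergent_seq_bounded (u : nat -> X) (x : X) : u @ \oo --> x ->
  exists n J, forall j, (J <= j)%N -> K n (u j).
Proof.
move=> /convergent_names[q [s [qx su qs]]].
have [n [k kP]] := name_bounded qx; have [J JP] := qs k.
by exists n, J => j /JP; exact: kP (su j).
Qed.

Lemma overt_eval p (A : closed_subset XX) a (U : open_space XX) y :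
  closed_name p A -> delta (open_space XX) a U -> sval A y -> sval U y = true ->
  exists k, forall p' (A' : closed_subset XX) a' (U' : open_space XX),
    closed_name p' A' -> delta (open_space XX) a' U' -> agree k p p' ->
    agree k a a' -> exists2 x, sval A' x & sval U' x = true.
Proof.
move=> pA aU Ay Uy.
have [|k kP] := @open_eval (open_space XX) p (meets_char (sval A)) a U pA aU.
  by apply/asboolP; exists y.
exists k => p' A' a' U' pA' aU' pp' aa'.
by have /asboolP := kP _ _ _ _ pA' aU' pp' aa'.
Qed.

Lemma overt_eval_open p (A : closed_subset XX) (U : set X) y :
  closed_name p A -> open U -> sval A y -> U y ->
  exists k, forall p' (A' : closed_subset XX),
    closed_name p' A' -> agree k p p' -> sval A' `&` U !=set0.
Proof.
move=> pA oU Ay Uy.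
pose u : open_space XX := exist _ (char U) (open_rep_open oU).
have [a au] := name_of_onto (delta (open_space XX)) u.
have [|k kP] := overt_eval pA au Ay; first exact/asboolP.
exists k => p' A' pA' pp'.
have [x A'x /asboolP Ux] := kP _ _ _ _ pA' au pp' (@agree_refl _ _).
by exists x.
Qed.

(** An overt name is a name of the collection of open sets that are met, so this is [open_curry] for
    that collection. *)
Lemma overt_curry (D : set baire) (A : baire -> set X) :
  (forall r a (U : open_space XX) y, D r -> delta (open_space XX) a U ->
    A r y -> sval U y = true ->
    exists k, forall r' a' (U' : open_space XX), D r' ->
      delta (open_space XX) a' U' -> agree k r r' -> agree k a a' ->
      exists2 x, A r' x & sval U' x = true) ->
  exists2 H : baire -> baire, locally_determined setT H &
    forall r (C : closed_subset XX), D r -> sval C = A r -> closed_name (H r) C.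
Proof.
move=> oA.
have [|H cH HP] := @open_curry (open_space XX) D (fun r => char (@meets XX (A r))).
  move=> r a U Dr aU /asboolP[y Ay Uy]; have [k kP] := oA r a U y Dr aU Ay Uy.
  by exists k => r' a' U' Dr' aU' rr' aa'; apply/asboolP; exact: kP aU' rr' aa'.
exists H => // r C Dr CA p U pU _.
have [|s [b [ps sb bU]]] := HP r Dr p U pU; first by exists (char (@meets XX (A r)) U).
by exists s, b; split=> //; rewrite /= CA.
Qed.

(** Branches name their limit points continuously, and admissibility turns them into names for [d].
    The limit belongs to the closed [A t] because the shrinking sets all meet it. *)
Lemma scheme_selection (D : set baire) (Q : baire -> seq nat -> Prop)
    (A : baire -> set X) (S : seq nat -> set X) : scheme S ->
  (forall t s, D t -> Q t s ->
    exists k, forall t', D t' -> agree k t t' -> Q t' s) ->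
  (forall t, D t -> Q t [::]) ->
  (forall t s, D t -> Q t s -> exists i, Q t (rcons s i)) ->
  (forall t s, D t -> Q t s -> S s `&` A t !=set0) ->
  (forall t, D t -> closed (A t)) ->
  exists2 F : partial_map baire baire, pcontinuous F &
    forall t, D t -> exists q x, [/\ F t q, d q x & A t x].
Proof.
move=> sS Qopen Q0 QS QA cA.
have [b cb bQ] := branch_selection Qopen Q0 QS.
pose R (c : baire) x := (forall n, S (mkseq c n) x) /\
  forall U, open U -> U x -> exists n, S (mkseq c n) `<=` U.
have RF c x y : R c x -> R c y -> x = y.
  move=> [_ xU] [yS _]; apply: contrapT => xy.
  have [||n nU] := xU (~` [set y]); last exact: nU (yS n) _.
    by apply: closed_openC; exact: (tower_set1 hK).
  by [].
have cR : pcontinuous (PartialMap RF).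
  apply/pcontinuousP => c x [_ xU] U oU Ux; have [n nU] := xU U oU Ux.
  exists n => c' x' [x'S _] /agree_mkseq cc'.
  by apply: nU; rewrite cc'.
have [G cG GP] := hd.2 _ cR.
pose F t q := D t /\ G (b t) q.
have FF t q q' : F t q -> F t q' -> q = q'.
  by move=> [_ Gq] [_ Gq']; exact: graph_functional Gq Gq'.
exists (PartialMap FF).
  apply/pcontinuous_baireP => t q [Dt Gq] n.
  have /pcontinuous_baireP/(_ _ _ Gq n)[l lP] := cG.
  have [k kP] := agree_uniform cb l Dt.
  by exists k => t' q' [Dt' Gq'] tt'; apply: lP Gq' _ => i il; exact: kP.
move=> t Dt.
have [|x [xS xU]] := sS (b t).
  by move=> n; have [x [Sx _]] := QA t _ Dt (bQ t n Dt); exists x.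
have [q Gq qx] := (GP (b t) x).1 (conj xS xU).
exists q, x; split=> //; rewrite (closure_id (A t)).1; last exact: cA.
move=> B; rewrite nbhsE => -[U [oU Ux] UB].
have [n nU] := xU U oU Ux; have [y [Sy Ay]] := QA t _ Dt (bQ t n Dt).
by exists y; split=> //; exact/UB/nU.
Qed.

End Names.

(** * Overt choice *)

Section Choice.
Variables (X : topologicalType) (K : nat -> set X) (d : representation X).
Hypotheses (hK : tower K) (hd : admissible d).
Let XX := RepSpace d.

(** [P] is a promise: meeting [S s] need be observable only among the overt sets that satisfy it. *)
Lemma overt_scheme_selection (P : set (closed_subset XX)) (S : seq nat -> set X) :
  scheme S ->
  (forall s x, S s x -> exists i, S (rcons s i) x) ->
  (forall A, P A -> sval A `&` S [::] !=set0) ->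
  (forall s p (A : closed_subset XX), closed_name p A -> P A ->
    sval A `&` S s !=set0 -> exists k, forall p' (A' : closed_subset XX),
      closed_name p' A' -> P A' -> agree k p p' -> sval A' `&` S s !=set0) ->
  exists2 F : partial_map baire baire, pcontinuous F &
    forall p (A : closed_subset XX), closed_name p A -> P A ->
      exists q x, [/\ F p q, d q x & sval A x].
Proof.
move=> sS SS S0 Sopen.
pose D : set baire := [set p | exists2 A : closed_subset XX, closed_name p A & P A].
pose Q (p : baire) s := exists A : closed_subset XX,
  [/\ closed_name p A, P A & sval A `&` S s !=set0].
pose A0 (p : baire) : set X := [set x | exists2 A : closed_subset XX,
  closed_name p A & sval A x].
have A0E p (A : closed_subset XX) : closed_name p A -> A0 p = sval A.
  move=> pA; apply/seteqP; split=> [x [B pB]|x Ax]; last by exists A.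
  by rewrite (closed_name_functional pB pA).
have [|||||F cF FP] := @scheme_selection X K d hK hd D Q A0 S sS.
- move=> p s _ [A [pA PA AS]]; have [k kP] := Sopen s p A pA PA AS.
  by exists k => p' [A' pA' PA'] pp'; exists A'; split=> //; exact: kP pA' PA' pp'.
- by move=> p [A pA PA]; exists A; split=> //; exact: S0.
- move=> p s _ [A [pA PA [x [Ax Sx]]]]; have [i Si] := SS s x Sx.
  by exists i, A; split=> //; exists x.
- by move=> p s _ [A [pA PA [x [Ax Sx]]]]; exists x; split=> //; exists A.
- move=> p [A pA _]; rewrite (A0E _ _ pA).
  by apply: (rep_closed_closed hK hd); exact: svalP A.
exists F => // p A pA PA; have [|q [x [Fpq qx A0x]]] := FP p; first by exists A.
by exists q, x; split=> //; rewrite -(A0E p).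
Qed.

Lemma overt_choice_open (Y : set X) : open Y ->
  (forall y, Y y -> exists n, interior (K n) y) ->
  exists2 F : partial_map baire baire, pcontinuous F &
    forall p (A : closed_subset XX), closed_name p A -> sval A `&` Y !=set0 ->
      exists q x, [/\ F p q, d q x & sval A x].
Proof.
move=> oY YK; have [S [S0 oS SY SS sS]] := open_scheme hK oY YK.
apply: (@overt_scheme_selection [set A | sval A `&` Y !=set0] S) => //.
  by move=> A /=; rewrite S0.
move=> s p A pA _ [x [Ax Sx]].
have [k kP] := overt_eval_open hd pA (oS s) Ax Sx.
by exists k => p' A' pA' _; exact: kP.
Qed.

Lemma overt_choice_continuous : (forall x, ~ wild K x) -> mcontinuous (VC XX).
Proof.
move=> tame; have [|F cF FP] := overt_choice_open (@openT X).
  by move=> y _; apply/wildPn.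
exists F => // p A pA [x Ax].
have [|q [y [Fpq qy Ay]]] := FP p A pA; first by exists x.
by exists q, y.
Qed.

Lemma open_eval_seq (u : nat -> X) (x : X) a (U : open_space XX) :
  u @ \oo --> x -> delta (open_space XX) a U -> sval U x = true ->
  exists k, forall a' (U' : open_space XX) j, delta (open_space XX) a' U' ->
    agree k a a' -> (k <= j)%N -> sval U' (u j) = true.
Proof.
move=> ux aU Ux; have [q [s [qx su qs]]] := convergent_names hd ux.
have [k kP] := open_eval aU qx Ux; have [J JP] := qs k.
exists (maxn k J) => a' U' j aU' aa' kj.
apply: (kP a' U' (s j)) => //; first by apply: agree_leq aa'; exact: leq_maxl.
by apply: JP; apply: leq_trans kj; exact: leq_maxr.
Qed.

Lemma open_eval_point (x : X) a (U : open_space XX) :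
  delta (open_space XX) a U -> sval U x = true ->
  exists k, forall a' (U' : open_space XX), delta (open_space XX) a' U' ->
    agree k a a' -> sval U' x = true.
Proof.
move=> aU Ux; have [q qx] := name_of_onto d x.
have [k kP] := open_eval aU (qx : delta XX q x) Ux.
by exists k => a' U' aU' aa'; exact: kP aU' qx aa' _.
Qed.

Lemma ACC_le_overt_choice (x : X) : frechet_urysohn X -> wild K x ->
  weihrauch_le ACC (VC XX).
Proof.
move=> FU wx.
have /choice[u uP] i : exists u : nat -> X,
    (forall j, ~ K i (u j)) /\ u @ \oo --> x.
  have : closure (~` K i) x.
    move=> B xB; apply: contrapT => nB; apply: (wx i); apply: filterS xB => y By.
    by apply: contrapT => nKy; apply: nB; exists y.
  by rewrite FU => -[u uK ux]; exists u.
have [m Kx] := tower_cover hK x.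
(* Since [u i j] may converge to [x] arbitrarily slowly in [i], the set for
   0^j (i+1) 0^omega also contains the terms up to [i] of the fixed sequence
   [w]; these avoid a neighbourhood of [x] and so do not reveal [i]. *)
pose w := u m.
have wx_ l : w l <> x by move=> wl; apply: ((uP m).1 l); rewrite -/w wl.
pose Ar (r : baire) : set X := [set y | (r = (fun=> 0%N) /\ y = x) \/
  exists i j, r j = i.+1 /\ (y = u i j \/ exists2 l, (l <= i)%N & y = w l)].
pose D : set baire := [set r | exists A : cosingleton, acc_name r A].
have Ar0 : Ar (fun=> 0%N) = [set x].
  by apply/seteqP; split=> [y [[_ ->]|[i [j []]]]|y ->] //; left.
have ArS i j : Ar (fun n => if n == j then i.+1 else 0%N) `<=`
    [set u i j] `|` w @` `I_i.+1.
  move=> y [[/(congr1 (@^~ j))]|[i' [j' []]]]; first by rewrite eqxx.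
  by case: eqP => // -> [->] [->|[l li ->]]; [left | right; exists l].
have cAr r : D r -> closed (Ar r).
  move=> [A [[-> _]|[i [j [-> _]]]]]; first by rewrite Ar0; exact: (tower_set1 hK).
  apply: (tower_closed_finite hK).
  apply: (sub_finite_set (@ArS i j)); rewrite finite_setU; split=> //.
  by apply: finite_image; exact: finite_II.
have [|H cH HP] := @overt_curry X d D Ar.
  move=> r a U y Dr aU [[r0 ->]|[i [j [rj yE]]]] Uy; last first.
    have [k kP] := open_eval_point aU Uy.
    exists (maxn k j.+1) => r' a' U' _ aU' rr' aa'; exists y.
      by right; exists i, j; split=> //; rewrite -rr'// leq_max ltnSn orbT.
    by apply: kP aU' _; apply: agree_leq aa'; exact: leq_maxl.
  have [k0 k0P] := open_eval_point aU Uy.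
  have [L LP] := open_eval_seq (uP m).2 aU Uy.
  (* For the finitely many [i < L] one threshold [k] puts the terms [u i j] with [j >= k] into the
     open set; for [i >= L] the set contains [w L], which is in it already. *)
  have [k kP] : exists k, forall i a' (U' : open_space XX) j, (i < L)%N ->
      delta (open_space XX) a' U' -> agree k a a' -> (k <= j)%N ->
      sval U' (u i j) = true.
    elim: (L) => [|l [k kP]]; first by exists 0%N.
    have [k' k'P] := open_eval_seq (uP l).2 aU Uy.
    exists (maxn k k') => i a' U' j; rewrite ltnS leq_eqVlt => /orP[/eqP ->|il].
      move=> aU' aa'; rewrite geq_max => /andP[_].
      by apply: k'P aU' _; apply: agree_leq aa'; exact: leq_maxr.
    move=> aU' aa'; rewrite geq_max => /andP[+ _].
    by apply: kP il aU' _; apply: agree_leq aa'; exact: leq_maxl.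
  exists (maxn (maxn k0 L) k) => r' a' U' [A' r'A'] aU' rr' aa'.
  have aa0 : agree k0 a a' by apply: agree_leq aa'; rewrite !leq_max leqnn.
  have aaL : agree L a a' by apply: agree_leq aa'; rewrite !leq_max leqnn orbT.
  have aak : agree k a a' by apply: agree_leq aa'; rewrite !leq_max leqnn orbT.
  case: r'A' => [[r'0 _]|[i [j [r'E _]]]].
    by exists x; [left | exact: k0P aU' aa0].
  have kj : (k <= j)%N.
    rewrite leqNgt; apply/negP => jk; have := rr' j.
    by rewrite r0 r'E eqxx !leq_max jk orbT => /(_ isT).
  have r'j : r' j = i.+1 by rewrite r'E eqxx.
  have [iL|Li] := ltnP i L.
    exists (u i j); last exact: kP iL aU' aak kj.
    by right; exists i, j; split=> //; left.
  exists (w L); last exact: LP aU' aaL (leqnn _).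
  by right; exists i, j; split=> //; right; exists L.
pose D' : set baire := [set t | exists r s y,
  [/\ t = bpair r s, D r, d s y & Ar r y]].
pose P t n := forall r s (A : cosingleton), t = bpair r s -> acc_name r A -> sval A n.
have [|F cF FP] := @nat_selection D' P.
  move=> t [r [s [y [-> [A rA] sy Ay]]]].
  have accj i j (r' : baire) (B : cosingleton) :
      acc_name r' B -> r' j = i.+1 -> sval B = ~` [set i].
    move=> [[-> _]//|[i' [j' [-> ->]]]].
    by case: eqP => // _ [->].
  case: rA => [[r0 AE]|[i [j [rE AE]]]]; last first.
    (* The entry that excludes [i] is visible, so any other number answers all names sharing it;
       doubling accounts for the pairing. *)
    exists i.+1, (j.+1).*2 => _ [r1 [s1 [y1 [-> _ _ _]]]] tt' r' s' B.
    move=> /bpair_inj[<- _] r1B; rewrite (accj i j _ _ r1B).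
      by move=> /eqP; rewrite (gtn_eqF (ltnSn i)).
    by have [/(_ j (ltnSn j)) <- _] := agree_bpair tt'; rewrite rE eqxx.
  have yx : y = x by move: Ay; rewrite r0 Ar0.
  rewrite yx in sy.
  have [N [k1 k1P]] := name_bounded hK hd sy.
  have [||k2 k2P] := @name_continuous X d hd s x (~` (w @` `I_N.+1)) sy.
  - apply: closed_openC; apply: (tower_closed_finite hK); apply: finite_image.
    exact: finite_II.
  - by move=> [l _ /wx_].
  (* The name of [y1] is committed to [K N] and away from the first terms of [w], while a set
     excluding [N] would consist of such terms and a point [u N j] outside [K N]. *)
  exists N, (maxn k1 k2).*2 => _ [r1 [s1 [y1 [-> Dr1 sy1 Ay1]]]] tt'.
  move=> r' s' B /bpair_inj[r1E _] r'B; rewrite -{}r1E in r'B.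
  have [_ ss] := agree_bpair tt'.
  have Ky1 : K N y1 by apply: k1P sy1 _; apply: agree_leq ss; exact: leq_maxl.
  have wy1 : ~ (w @` `I_N.+1) y1.
    by apply: k2P sy1 _; apply: agree_leq ss; exact: leq_maxr.
  case: r'B => [[_ ->]//|[i [j [r1E ->]]]] /= Ni.
  move: Ay1; rewrite r1E => /ArS; rewrite -Ni => -[y1u|]//.
  by apply: ((uP N).1 j); rewrite -y1u.
apply/weihrauch_leP; exists (fun_map setT H), F; split=> //.
  exact: fun_map_continuous.
move=> r A rA _; have Dr : D r by exists A.
pose C : closed_subset XX := exist _ (Ar r) (closed_rep_closed hd (cAr r Dr)).
have rC : closed_name (H r) C by exact: HP.
exists (H r), C; split=> //.
  case: rA => [[r0 _]|[i [j [r0 _]]]]; first by exists x; left.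
  by exists (u i j); right; exists i, j; split; [rewrite r0 eqxx | left].
move=> s y sy Ay; have [|q Fq Pq] := FP (bpair r s); first by exists r, s, y.
by exists q, (q 0%N); split=> //; exact: Pq rA.
Qed.

End Choice.

(** * The Fréchet-Urysohn case: wild points and comparison with LPO *)

Section FrechetUrysohn.
Variables (X : topologicalType) (K : nat -> set X) (d : representation X).
Hypotheses (hK : tower K) (hd : admissible d) (FU : frechet_urysohn X).
Let XX := RepSpace d.

(* Otherwise the wild points [y i] accumulate at some [z], while no sequence in
   [M], made of points near [y i] outside [K i], converges to [z]. *)
Lemma finite_wild m : finite_set (wild K `&` K m).
Proof.
apply: contrapT => infZ.
have [V [oV VP]] := tower_base hK m.
pose fin i := finite_set (wild K `&` K m `&` V i).
(* If every point of [K m] had a basic set containing finitely many wild points of [K m],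
   compactness would leave only finitely many in all. *)
have [z [Kz zP]] : exists z, K m z /\ forall i, V i z -> ~ fin i.
  apply: contrapT => nz; apply: infZ.
  pose T j := [set x | exists2 i, (i < j)%N /\ fin i & V i x].
  have [|||j KT] := @compact_increasing_cover _ (K m) T (tower_compact hK m).
  - move=> j; apply: open_nbhs_sub => x [i ij Vx]; exists (V i); split=> //.
    by move=> y Vy; exists i.
  - by move=> j x [i [ij fi] Vx]; exists i => //; split=> //; exact: ltnW.
  - move=> x Kx; apply: contrapT => nT; apply: nz; exists x; split=> // i Vx fi.
    by apply: nT; exists i.+1 => //; exists i.
  apply: (@sub_finite_set _ _
    (\bigcup_(i in [set i | (i < j)%N /\ fin i]) (wild K `&` K m `&` V i))).
    by move=> x [wx Kx]; have [i ij Vx] := KT x Kx; exists i.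
  apply: bigcup_finite; last by move=> i [].
  by apply: (@sub_finite_set _ _ `I_j) => [i []//|]; exact: finite_II.
have /choice[y yP] i : exists y, V i z -> [/\ V i y, K m y, wild K y & y <> z].
  have [Vz|nVz] := pselect (V i z); last by exists z.
  have [y [[[wy Ky] Vy] yz]] : exists y, (wild K `&` K m `&` V i) y /\ y <> z.
    apply: contrapT => ny; apply: (zP i Vz).
    apply: (@sub_finite_set _ _ [set z]); last exact: finite_set1.
    move=> y Zy; apply: contrapT => yz; by apply: ny; exists y.
  by exists y.
have /choice[W WP] i : exists W, V i z -> [/\ open W, W (y i) & ~ closure W z].
  have [Vz|nVz] := pselect (V i z); last by exists set0.
  have [_ _ _ yz] := yP i Vz; have [W ?] := tower_hausdorff_sep hK yz.
  by exists W.
(* Neighbourhoods of the wild point [y i] always leave [K i]; this puts [z] into the closure of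
   [M]. *)
pose M := [set x | exists2 i, V i z & W i x /\ ~ K i x].
have : closure M z.
  move=> B; rewrite nbhsE => -[U [oU Uz] UB].
  have [i [Vz VU]] := VP z U oU Uz Kz.
  have [Vy Ky wy _] := yP i Vz; have [oW Wy _] := WP i Vz.
  apply: contrapT => nB; apply: (wy i); rewrite /interior.
  have UWy : nbhs (y i) (U `&` W i).
    by apply: open_nbhs_nbhs; split; [exact: openI | split=> //; exact: VU].
  apply: filterS UWy => x [Ux Wx]; apply: contrapT => nKx.
  by apply: nB; exists x; split; [exists i | exact: UB].
rewrite FU => -[u uM uz].
have [n [J uK]] := convergent_seq_bounded hK hd uz.
(* Indices [i < n] are eventually excluded since [z] is outside the closure of [W i]; indices
   [i >= n] are excluded since [u j] lies in [K n], inside [K i]. *)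
have [N NP] : exists N, forall j, (N <= j)%N ->
    forall i, (i < n)%N -> V i z -> ~ W i (u j).
  elim: (n) => [|k [N NP]]; first by exists 0%N.
  have [Vz|nVz] := pselect (V k z); last first.
    exists N => j Nj i; rewrite ltnS leq_eqVlt => /orP[/eqP ->//|]; exact: NP.
  have [oW Wy nW] := WP k Vz.
  have oC : open (~` closure (W k)).
    by apply: closed_openC; exact: closed_closure.
  have [N' _ N'P] := uz _ (open_nbhs_nbhs (conj oC nW)).
  exists (maxn N N') => j; rewrite geq_max => /andP[Nj N'j] i.
  rewrite ltnS leq_eqVlt => /orP[/eqP -> _|]; last exact: NP.
  by move=> /subset_closure; exact: (N'P j N'j).
pose j := maxn J N.
have [i Vz [Wu nKu]] := uM j.
have [ni|ni] := leqP n i.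
  by apply: nKu; apply: (tower_incr hK ni); apply: uK; exact: leq_maxl.
exact: (NP j (leq_maxr _ _) i ni Vz).
Qed.

(** The trace on each [K n] is finite; so the wild points are a closed discrete set. *)
Lemma closed_sub_wild (B : set X) : B `<=` wild K -> closed B.
Proof.
move=> BN; rewrite -[X in closed X]setCK; apply: open_closedC.
apply: (tower_open hK) => n x nBx Kx; exists (~` (B `&` K n)); split.
- apply: closed_openC; apply: (tower_closed_finite hK).
  by apply: sub_finite_set (finite_wild n) => y [/BN ? ?].
- by case.
- by move=> y [Ky nBy] By; apply: nBy.
Qed.

Lemma countable_wild : countable (wild K).
Proof.
apply: (@sub_countable _ _ _ (\bigcup_n (wild K `&` K n))).
  apply: subset_card_le => x wx; have [n Kx] := tower_cover hK x.
  by exists n.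
by apply: bigcup_countable => // n _; apply: finite_set_countable; exact: finite_wild.
Qed.

(** Removing from [X] all wild points but [x] leaves an open set, which a set of wild points meets
    only by containing [x]; membership of [x] is thus observable. The first entry of a branch is the
    code of the chosen point. *)
Lemma overt_choice_wild : exists2 F : partial_map baire baire, pcontinuous F &
  forall p (A : closed_subset XX), closed_name p A -> sval A !=set0 ->
    sval A `<=` wild K -> exists q x, [/\ F p q, d q x & sval A x].
Proof.
have /countable_injP[e eI] := countable_wild.
pose S (s : seq nat) := [set x | wild K x /\ (if s is i :: _ then e x = i else True)].
have sS : scheme S.
  move=> b Sb; have [x [wx ex]] := Sb 1%N.
  exists x; split=> [[|n]|U oU Ux]; [by split | by split | exists 1%N].
  move=> y [wy ey]; rewrite (eI y x) ?inE//.
  exact: etrans ey (esym ex).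
have [|||F cF FP] := @overt_scheme_selection X K d hK hd
    [set A | sval A !=set0 /\ sval A `<=` wild K] S sS.
- move=> [|i s] x [wx Sx]; first by exists (e x).
  by exists 0%N.
- by move=> A [[x Ax] Aw]; exists x; split=> //; split=> //; exact: Aw.
- move=> s p A pA _ [x [Ax Sx]].
  have oU : open (~` (wild K `\ x)).
    by apply: closed_openC; apply: closed_sub_wild => y [].
  have Ux : (~` (wild K `\ x)) x by case=> _; apply.
  have [k kP] := overt_eval_open hd pA oU Ax Ux.
  exists k => p' A' pA' [_ A'w] pp'.
  have [y [A'y Uy]] := kP p' A' pA' pp'; exists y; split=> //.
  suff -> : y = x by [].
  by apply: contrapT => yx; apply: Uy; split=> //; exact: A'w.
by exists F => // p A pA An0 Aw; exact: FP.
Qed.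

Lemma overt_choice_le_LPO : weihrauch_le (VC XX) LPO.
Proof.
have [|F1 cF1 F1P] := overt_choice_open hK hd (open_tame K).
  by move=> y /wildPn.
have [F2 cF2 F2P] := overt_choice_wild.
(* A zero appears once a prefix of [p] forces every set so named to contain a tame point. *)
pose H (p : baire) : baire := fun n => if `[< forall p' (A : closed_subset XX),
  closed_name p' A -> agree n p p' -> sval A `&` ~` wild K !=set0 >] then 0%N else 1%N.
pose G t r := exists p s, t = bpair p s /\
  ((s 0%N = 1%N /\ F1 p r) \/ (s 0%N = 0%N /\ F2 p r)).
have GF t r r' : G t r -> G t r' -> r = r'.
  move=> [p [s [-> h]]] [p' [s' [/bpair_inj[<- <-] h']]].
  case: h h' => -[s0 Fr] [] [s0' Fr']; rewrite ?s0 // in s0'.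
    exact: graph_functional Fr Fr'.
  exact: graph_functional Fr Fr'.
apply/weihrauch_leP; exists (fun_map setT H), (PartialMap GF); split.
- apply: fun_map_continuous => p n _; exists n => p' _ pp'; rewrite /H.
  congr (if `[< _ >] then _ else _); apply/propext; split=> h p'' A pA pp''.
    by apply: (h p'') => //; exact: agree_trans pp' pp''.
  by apply: (h p'') => //; apply: agree_trans pp''; exact: agree_sym.
- apply/pcontinuous_baireP => _ r [p [s [-> h]]] n.
  have [k kP] : exists k, forall p' s' r', G (bpair p' s') r' -> s' 0%N = s 0%N ->
      agree k p p' -> agree n r r'.
    case: h => -[s0 Fr].
      have /pcontinuous_baireP/(_ _ _ Fr n)[k kP] := cF1.
      exists k => p' s' r' [p1 [s1 [/bpair_inj[<- <-]]]] [] [] s0' Fr' ss pp'.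
        exact: kP Fr' pp'.
      by move: s0'; rewrite ss s0.
    have /pcontinuous_baireP/(_ _ _ Fr n)[k kP] := cF2.
    exists k => p' s' r' [p1 [s1 [/bpair_inj[<- <-]]]] [] [] s0' Fr' ss pp'.
      by move: s0'; rewrite ss s0.
    exact: kP Fr' pp'.
  (* The successor makes the first entry of the answer visible even if [k] is 0, so the same one of
     [F1] and [F2] is used. *)
  exists k.+1.*2 => t' r' Gt' tt'.
  have [p' [s' [t'E _]]] := Gt'; rewrite t'E in Gt' tt'.
  have [pp' ss'] := agree_bpair tt'.
  apply: kP Gt' _ _; first by rewrite ss'.
  by apply: agree_leq pp'; exact: leqnSn.
move=> p A pA An0.
have HP : (exists k, H p k = 0%N) <-> sval A `&` ~` wild K !=set0.
  split=> [[k]|[x [Ax wx]]].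
    by rewrite /H; case: asboolP => // /(_ p A pA (@agree_refl _ _)).
  have [k kP] := overt_eval_open hd pA (open_tame K) Ax wx.
  by exists k; rewrite /H; case: asboolP.
exists (H p), (H p); split=> //.
  by exists `[< exists k, H p k = 0%N >].
move=> s w sw wE; have {wE}wE : w = `[< exists k, H p k = 0%N >] := wE.
rewrite wE in sw; have [Aw|Aw] := pselect (sval A `&` ~` wild K !=set0).
  have [q [x [Fq qx Ax]]] := F1P p A pA Aw; exists q, x; split=> //.
  exists p, s; split=> //; left; split=> //.
  rewrite [LHS]sw; case: asboolP => // -[]; exact/HP.
have [|q [x [Fq qx Ax]]] := F2P p A pA An0.
  by move=> x Ax; apply: contrapT => wx; apply: Aw; exists x.
exists q, x; split=> //; exists p, s; split=> //; right; split=> //.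
by rewrite [LHS]sw; case: asboolP => // /HP.
Qed.

Lemma not_LPO_le_overt_choice : ~ weihrauch_le LPO (VC XX).
Proof.
move=> /weihrauch_leP[H [G [cH cG HG]]].
pose one : baire := fun=> 1%N.
pose r n : baire := fun k => if (k < n)%N then 1%N else 0%N.
have r1 k n : (k <= n)%N -> agree k one (r n).
  by move=> kn i ik; rewrite /r (leq_trans ik kn).
have LPO1 : (fun p : baire => `[< exists k, p k = 0%N >]) one = false.
  by apply/asboolPn => -[].
have LPOr n : (fun p : baire => `[< exists k, p k = 0%N >]) (r n) = true.
  by apply/asboolP; exists n; rewrite /r ltnn.
have HG' p : exists q (A : closed_subset XX), [/\ H p q, closed_name q A,
    sval A !=set0 & forall s y, d s y -> sval A y ->
      exists2 t, G (bpair p s) t & t 0%N = nat_of_bool `[< exists k, p k = 0%N >]].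
  have [|q [A [Hq qA An0 h]]] := HG p p erefl.
    by exists `[< exists k, p k = 0%N >].
  exists q, A; split=> // s y sy Ay; have [t [b [Gt tb bE]]] := h s y sy Ay.
  by exists t => //; rewrite -[`[< _ >]](bE : b = _).
have [q [A [Hq qA [y Ay] GA]]] := HG' one.
have /choice[qA' qAP] n : exists qA : baire * closed_subset XX,
    [/\ H (r n) qA.1, closed_name qA.1 qA.2 & forall s y, d s y -> sval qA.2 y ->
      exists2 t, G (bpair (r n) s) t & t 0%N = 1%N].
  have [qn [An [Hqn qAn _ h]]] := HG' (r n); exists (qn, An); split=> // s y' sy' Ay'.
  by have [t Gt t1] := h s y' sy' Ay'; exists t => //; rewrite t1 LPOr.
pose B n := sval (qA' n).2.
(* Names of such [u j] and of [y], paired with [r (f j)] and [one], would make the output of [G]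
   jump from 1 to 0 in the limit. *)
have noseq (u : nat -> X) (f : nat -> nat) : u @ \oo --> y ->
    (forall j, B (f j) (u j)) ->
    (forall L, exists J, forall j, (J <= j)%N -> (L <= f j)%N) -> False.
  move=> uy uB foo; have [s [sj [sy su ss]]] := convergent_names hd uy.
  have [t Gt t0] := GA s y sy Ay.
  have /pcontinuous_baireP/(_ _ _ Gt 1%N)[k kP] := cG.
  have [J JP] := ss k; have [J' J'P] := foo k.
  pose j := maxn J J'.
  have [_ _ /(_ _ _ (su j) (uB j))[t' Gt' t'1]] := qAP (f j).
  have := kP _ _ Gt' (bpair_agree (r1 _ _ (J'P j (leq_maxr _ _))) (JP j (leq_maxl _ _))).
  by move=> /(_ 0%N isT); rewrite t0 t'1 LPO1.
have cB n : closed (B n).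
  by apply: (rep_closed_closed hK hd); exact: svalP (qA' n).2.
have clB m : closure (\bigcup_(n in [set n | (m <= n)%N]) B n) y.
  move=> W; rewrite nbhsE => -[U [oU Uy] UW].
  have [k kP] := overt_eval_open hd qA oU Ay Uy.
  have /pcontinuous_baireP/(_ _ _ Hq k)[l lP] := cH.
  have [Hn nA _] := qAP (maxn l m).
  have [z [Bz Uz]] := kP _ _ nA (lP _ _ Hn (r1 _ _ (leq_maxl _ _))).
  by exists z; split; [exists (maxn l m) => //; exact: leq_maxr | exact: UW].
(* If [y] lies in [B n] for arbitrarily large [n], the constant sequence contradicts [noseq];
   otherwise the Fréchet-Urysohn property gives a sequence. *)
have [inf|fin] := pselect (forall m, exists2 n, (m <= n)%N & B n y).
  have /choice[f fP] m : exists n, (m <= n)%N /\ B n y.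
    by have [n ? ?] := inf m; exists n.
  apply: (noseq (fun=> y) f); first exact: cvg_cst.
    by move=> j; have [] := fP j.
  by move=> L; exists L => j Lj; apply: leq_trans Lj _; have [] := fP j.
have {fin}[m mP] : exists m, forall n, (m <= n)%N -> ~ B n y.
  move/existsNP: fin => [m mP]; exists m => n mn Bn; apply: mP; by exists n.
have := clB m; rewrite FU => -[u uB uy].
have /choice[f fP] j : exists n, (m <= n)%N /\ B n (u j).
  by have [n mn Bn] := uB j; exists n.
apply: (noseq u f uy); first by move=> j; have [] := fP j.
(* The indices [f j] tend to infinity because each closed [B L] with [L >= m] misses [y] and so is
   eventually left by [u]. *)
elim=> [|L [J JP]]; first by exists 0%N.
have [mL|Lm] := leqP m L; last first.
  by exists 0%N => j _; apply: leq_trans Lm _; have [] := fP j.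
have oC : open (~` B L) by apply: closed_openC; exact: cB.
have [J' _ J'P] := uy _ (open_nbhs_nbhs (conj oC (mP L mL))).
exists (maxn J J') => j; rewrite geq_max => /andP[Jj J'j].
rewrite ltn_neqAle JP// andbT; apply/eqP => Lf.
by apply: (J'P j J'j); rewrite Lf; have [] := fP j.
Qed.

End FrechetUrysohn.

(** * The case that is not Fréchet-Urysohn, and the general upper bound *)

Section NotFrechetUrysohn.
Variables (X : topologicalType) (K : nat -> set X) (d : representation X).
Hypotheses (hK : tower K) (hd : admissible d).
Let XX := RepSpace d.

Lemma open_space_open (U : open_space XX) : open [set x | sval U x = true].
Proof.
apply: (rep_open_open hK hd).
have UE : char [set x | sval U x = true] = sval U.
  by apply: funext => x; rewrite /char; apply/idP/idP => [/asboolP|/asboolP].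
by rewrite /rep_open UE; exact: svalP U.
Qed.

(** One point of [M] is picked for every basic trace that [M] meets, with [m0] as default. *)
Lemma dense_sequence (M : set X) : M !=set0 ->
  exists2 m : nat -> X, (forall i, M (m i)) & M `<=` closure (range m).
Proof.
move=> [m0 Mm0]; have /choice[V VP] := tower_base hK.
have /choice[m mP] c : exists y, M y /\ forall n i, unpickle c = Some (n, i) ->
    (M `&` K n `&` V n i) !=set0 -> (K n `&` V n i) y.
  case E: (unpickle c) => [[n i]|]; last by exists m0.
  have [[y [[My Ky] Vy]]|nex] := pselect ((M `&` K n `&` V n i) !=set0).
    by exists y; split=> // n' i' [<- <-].
  by exists m0; split=> // n' i' [<- <-].
exists m => [i|x Mx B]; first by have [] := mP i.
rewrite nbhsE => -[U [oU Ux] UB].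
have [n Kx] := tower_cover hK x; have [i [Vx VU]] := (VP n).2 x U oU Ux Kx.
exists (m (pickle (n, i))); split; first by exists (pickle (n, i)).
apply/UB/VU; apply: (mP (pickle (n, i))).2; first exact: pickleK.
by exists x.
Qed.

Lemma LPO_le_overt_choice : ~ frechet_urysohn X -> weihrauch_le LPO (VC XX).
Proof.
move=> /existsNP[M MP].
have [x clx nseq] : exists2 x, closure M x &
    forall u : nat -> X, (forall n, M (u n)) -> ~ (u @ \oo --> x).
  apply: contrapT => nx; apply: MP; apply/seteqP; split=> x.
    move=> clx; apply: contrapT => nu; apply: nx; exists x => // u uM ux.
    by apply: nu; exists u.
  move=> [u uM ux] B /ux[N _ NB]; exists (u N); split=> //.
  exact: (NB N (leqnn N)).
have nclx n : ~ closure (K n `&` M) x.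
  by move=> /(tower_closure_seq hK)[u uM]; exact: nseq.
have [m mM clm] : exists2 m : nat -> X, (forall i, M (m i)) & closure (range m) x.
  have [y [My _]] := clx setT filterT.
  have [|m mM Mm] := @dense_sequence M; first by exists y.
  exists m => //; rewrite (closure_id (closure (range m))).1.
    exact: closureS clx.
  exact: closed_closure.
pose Z (r : baire) k := r k = 0%N /\ forall j, (j < k)%N -> r j <> 0%N.
have Zex (r : baire) k : r k = 0%N -> exists l, Z r l.
  move=> rk; have ex : exists l, r l == 0%N by exists k; exact/eqP.
  have [l /eqP rl lmin] := ex_minnP ex; exists l; split=> // j jl /eqP /lmin.
  by rewrite leqNgt jl.
have ZU (r : baire) k l : Z r k -> Z r l -> k = l.
  move=> [rk kP] [rl lP]; case: (ltngtP k l) => // [/lP|/kP]; exact.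
have Zagree (r r' : baire) k : agree k.+1 r r' -> Z r k -> Z r' k.
  move=> rr' [rk kP]; split=> [|j jk]; first by rewrite -rr'.
  by rewrite -rr'; [exact: kP | exact: ltnW].
(* The answer set is [x] alone while no zero occurs, and the first [k.+1] points of [m] once the
   first zero is at [k]. *)
pose Ar (r : baire) : set X := [set y | ((forall k, r k <> 0%N) /\ y = x) \/
  exists k, Z r k /\ exists2 i, (i <= k)%N & y = m i].
have ArZ r k : Z r k -> Ar r `<=` m @` `I_k.+1.
  move=> rk y [[/(_ k)]|[l [rl [i il ->]]]]; first by case: rk.
  by exists i => //=; rewrite (ZU _ _ _ rk rl).
have cAr r : closed (Ar r).
  have [[k rk]|nz] := pselect (exists k, Z r k).
    apply: (tower_closed_finite hK); apply: sub_finite_set (ArZ r k rk) _.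
    by apply: finite_image; exact: finite_II.
  suff -> : Ar r = [set x] by exact: (tower_set1 hK).
  apply/seteqP; split=> [y [[_ ->//]|[k [rk _]]]|y ->].
    by case: nz; exists k.
  by left; split=> // k /Zex.
have [|H cH HP] := @overt_curry X d setT Ar.
  move=> r a U y _ aU [[rz ->]|[k [rk [i ik yE]]]] Uy; last first.
    have [l lP] := open_eval_point aU Uy.
    exists (maxn l k.+1) => r' a' U' _ aU' rr' aa'; exists y.
      right; exists k; split; last by exists i.
      by apply: Zagree rk; apply: agree_leq rr'; exact: leq_maxr.
    by apply: lP aU' _; apply: agree_leq aa'; exact: leq_maxl.
  have oU := open_space_open U.
  (* An open set around [x] contains some [m i], and a first zero beyond [i] leaves [m i] in the
     answer set; so an overt name can be given before a zero is seen. *)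
  have [_ [[i _ <-] Umi]] := clm _ (open_nbhs_nbhs (conj oU Uy)).
  have [k0 k0P] := open_eval_point aU Uy.
  have [k1 k1P] := open_eval_point aU Umi.
  exists (maxn (maxn k0 k1) i) => r' a' U' _ aU' rr' aa'.
  have [[k r'k]|nz] := pselect (exists k, Z r' k); last first.
    exists x; first by left; split=> // k /Zex.
    by apply: k0P aU' _; apply: agree_leq aa'; rewrite !leq_max leqnn.
  exists (m i); last first.
    by apply: k1P aU' _; apply: agree_leq aa'; rewrite !leq_max leqnn orbT.
  right; exists k; split=> //; exists i => //.
  rewrite leqNgt; apply/negP => ki; apply: (rz k); rewrite rr'; first by case: r'k.
  by rewrite !leq_max ki orbT.
pose D : set baire := [set t | exists r s y, [/\ t = bpair r s, d s y & Ar r y]].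
pose lpo (r : baire) := `[< exists k, r k = 0%N >].
pose P t n := forall r s, t = bpair r s -> n = nat_of_bool (lpo r).
have [|F cF FP] := @nat_selection D P.
  move=> _ [r [s [y [-> sy [[rz yx]|[k [rk _]]]]]]]; last first.
    exists 1%N, k.+1.*2 => t' _ tt' r' s' t'E; rewrite t'E in tt'.
    have [/Zagree/(_ rk)[r'k _] _] := agree_bpair tt'.
    by rewrite /lpo; case: asboolP => // -[]; exists k.
  rewrite yx in sy; have [N [k1 k1P]] := name_bounded hK hd sy.
  have oC : open (~` closure (K N `&` M)).
    by apply: closed_openC; exact: closed_closure.
  have [k2 k2P] := name_continuous hd sy oC (nclx N).
  (* A prefix of the name of [x] commits to [K N] and avoids the closure of its part in [M], which
     rules out all the points of [m]. *)
  exists 0%N, (maxn k1 k2).*2 => _ [r1 [s1 [y1 [-> sy1 Ay1]]]] tt'.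
  move=> r' s' /bpair_inj[<- _]; rewrite /lpo; case: asboolP => // -[k rk].
  have [_ ss] := agree_bpair tt'.
  have Ky1 : K N y1 by apply: k1P sy1 _; apply: agree_leq ss; exact: leq_maxl.
  have : ~ closure (K N `&` M) y1.
    by apply: k2P sy1 _; apply: agree_leq ss; exact: leq_maxr.
  case; apply: subset_closure; split=> //.
  by have [l /ArZ/(_ _ Ay1)[i _ <-]] := Zex _ _ rk.
apply/weihrauch_leP; exists (fun_map setT H), F; split=> //.
  exact: fun_map_continuous.
move=> r r' rE _; have {rE}rE : r = r' := rE; subst r'.
pose C : closed_subset XX := exist _ (Ar r) (closed_rep_closed hd (cAr r)).
exists (H r), C; split=> //; first exact: HP.
  have [[k rk]|nz] := pselect (exists k, Z r k).
    by exists (m 0%N); right; exists k; split=> //; exists 0%N.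
  by exists x; left; split=> // k /Zex.
move=> s y sy Ay; have [|q Fq Pq] := FP (bpair r s); first by exists r, s, y.
by exists q, (lpo r); split=> //; exact: Pq.
Qed.

(** The last clause, joint openness in [g] and the point, allows a name of [U g] to be computed
    continuously from [g]. *)
Lemma closed_nbhd_family (C : set X) : closed C -> exists U : baire -> set X,
  [/\ forall g, open (U g), forall g, C `<=` U g,
      forall W, open W -> C `<=` W -> exists g, U g `<=` W &
      forall g q x, d q x -> U g x -> exists k, forall g' q' x',
        agree k g g' -> d q' x' -> agree k q q' -> U g' x'].
Proof.
(* [g n] codes a finite union of basic sets covering, within [K n], the part of
   the neighbourhood already built; an invalid code stands for the whole space. *)
move=> cC; have /choice[V VP] := tower_base hK.
pose N n l := [set x | exists2 i, i \in CodeSeq.decode l & V n i x].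
have oN n l : open (N n l).
  apply: open_nbhs_sub => x [i il Vx]; exists (V n i); split=> //.
    exact: (VP n).1.
  by move=> y Vy; exists i.
pose step n T l := if `[< T `<=` N n l >] then N n l else setT.
have Tstep n T l : T `<=` step n T l by rewrite /step; case: asboolP.
have ostep n T l : open (step n T l).
  by rewrite /step; case: asboolP => [TN|nTN]; [exact: oN | exact: openT].
pose O := fix O (g : baire) n := if n is n'.+1
  then step n ((C `&` K n) `|` closure (K n' `&` O g n')) (g n)
  else step 0%N (C `&` K 0%N) (g 0%N).
have Oagree g g' n : agree n.+1 g g' -> O g n = O g' n.
  elim: n => [|n IH] gg' /=; first by rewrite gg'.
  by rewrite IH ?gg'//; apply: agree_leq gg'.
have CO g n : C `&` K n `<=` O g n.
  by case: n => [|n] x Cx /=; apply: Tstep; [exact: Cx | left].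
have OS g n : K n `&` O g n `<=` O g n.+1.
  by move=> x KOx /=; apply: Tstep; right; exact: subset_closure.
have oO g n : open (O g n).
  by case: n => [|n]; exact: ostep.
have Oincr g i n : (i <= n)%N -> K i `&` O g i `<=` O g n.
  elim: n => [|n IH]; first by rewrite leqn0 => /eqP -> x [].
  rewrite leq_eqVlt => /orP[/eqP -> x []//|iin x KOx].
  by apply: OS; split; [exact: (tower_incr hK (iin : (i <= n)%N)) KOx.1 | exact: IH].
exists (fun g => \bigcup_n (K n `&` O g n)); split.
- by move=> g; apply: (tower_bigcup_open hK).
- move=> g x Cx; have [n Kx] := tower_cover hK x.
  by exists n => //; split=> //; exact: CO.
- move=> W oW CW.
  pose P n (s : nat * set X) := closure (K n `&` s.2) `<=` W.
  pose Q n (s t : nat * set X) :=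
    t.2 = step n.+1 ((C `&` K n.+1) `|` closure (K n `&` s.2)) t.1.
  have next n T : closed T -> T `<=` K n -> T `<=` W ->
      exists l, closure (K n `&` step n T l) `<=` W.
    move=> cT TK TW.
    have [s [Ts sW]] := tower_nbhs_compact hK (VP n).1 (VP n).2 TK cT oW TW.
    have NE : N n (CodeSeq.code s) = [set x | exists2 i, i \in s & V n i x].
      by rewrite /N CodeSeq.codeK.
    by exists (CodeSeq.code s); rewrite /step NE; case: asboolP.
  have [||s sP] := @dependent_choice_nat _
      (fun n s => P n s /\ (n = 0%N -> s.2 = step 0%N (C `&` K 0%N) s.1)) Q.
  + have [|||l lW] := next 0%N (C `&` K 0%N).
    * by apply: closedI => //; exact: (tower_closed hK).
    * by move=> x [].
    * by move=> x [/CW].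
    by exists (l, step 0%N (C `&` K 0%N) l).
  + move=> n s [Ps _].
    have [|||l lW] := next n.+1 ((C `&` K n.+1) `|` closure (K n `&` s.2)).
    * apply: closedU; last exact: closed_closure.
      by apply: closedI => //; exact: (tower_closed hK).
    * move=> x [[]//|clx]; apply: (tower_incr hK (leqnSn n)).
      rewrite (closure_id (K n)).1; last exact: (tower_closed hK).
      by apply: closureS clx => ? [].
    * by move=> x [[/CW]//|]; exact: Ps.
    exists (l, step n.+1 ((C `&` K n.+1) `|` closure (K n `&` s.2)) l) => //.
  exists (fun n => (s n).1) => x [n _ KOx].
  have OE : O (fun n => (s n).1) n = (s n).2.
    elim: (n) => [|j IH] /=; first by have [[_ ->]] := sP 0%N.
    by rewrite IH; have [_ ->] := sP j.
  by rewrite OE in KOx; have [[Pn _] _] := sP n; apply/Pn/subset_closure.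
- move=> g q x qx [n _ [Kx Ox]].
  have [m [k1 k1P]] := name_bounded hK hd qx.
  have Km : K m x by exact: k1P qx (@agree_refl _ _).
  (* Stage [j] serves all nearby points, which lie in [K m], and depends on the first [j.+1] entries
     of [g] only. *)
  pose j := maxn m n.
  have Oj : O g j x by apply: (Oincr g n j (leq_maxr _ _)); split.
  have [k2 k2P] := name_continuous hd qx (oO g j) Oj.
  exists (maxn (maxn k1 k2) j.+1) => g' q' x' gg' qx' qq'.
  exists j => //; split.
    apply: (tower_incr hK (leq_maxl m n)); apply: k1P qx' _.
    by apply: agree_leq qq'; rewrite !leq_max leqnn.
  rewrite -(Oagree g); last by apply: agree_leq gg'; exact: leq_maxr.
  by apply: k2P qx' _; apply: agree_leq qq'; rewrite !leq_max leqnn orbT.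
Qed.

(** If [A] misses [C i], its complement is a neighbourhood of [C i]; so meeting [C i] amounts to
    meeting every [U i g]. Each instance has finite evidence, and quantifying over all [g] becomes
    well-foundedness. *)
Lemma pi11_decision (C : nat -> set X) : (forall i, closed (C i)) ->
  exists2 H : baire -> baire, locally_determined setT H &
    forall p (A : closed_subset XX), closed_name p A ->
      delta (seq_space sierpinski_pi11) (H p)
        (fun i => `[< sval A `&` C i !=set0 >]).
Proof.
move=> cC; have /choice[U UP] : forall i, exists U : baire -> set X,
    [/\ forall g, open (U g), forall g, C i `<=` U g,
        forall W, open W -> C i `<=` W -> exists g, U g `<=` W &
        forall g q x, d q x -> U g x -> exists k, forall g' q' x',
          agree k g g' -> d q' x' -> agree k q q' -> U g' x'].
  by move=> i; exact: closed_nbhd_family.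
(* An infinite branch of [T i p] is a [g] whose neighbourhood [U i g] of [C i]
   misses the set named by [p]. *)
pose T i p w := ~~ `[< forall p' (A : closed_subset XX) (g : baire),
  closed_name p' A -> agree (size w) p p' -> mkseq g (size w) = w ->
  sval A `&` U i g !=set0 >].
pose H (p : baire) : baire := fun c =>
  nat_of_bool (T (Cantor.of_nat c).1 p (CodeSeq.decode (Cantor.of_nat c).2)).
exists H.
  move=> p c _; set w := CodeSeq.decode (Cantor.of_nat c).2.
  exists (size w) => p' _ pp'; rewrite /H -/w; congr (nat_of_bool (~~ `[< _ >])).
  apply/propext; split=> h p'' A g pA pp''; apply: (h p'') => //.
    exact: agree_trans pp' pp''.
  by apply: agree_trans pp''; exact: agree_sym.
move=> p A pA i; exists (T i p); split.
  split=> [u v|u]; last by rewrite /bproj /H Cantor.cancel_of_to /= CodeSeq.codeK.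
  apply: contraNN => /asboolP h; apply/asboolP => p' B g pB pp' guv.
  apply: (h p') => //.
    by apply: agree_leq pp'; rewrite size_cat leq_addr.
  have := congr1 (take (size u)) guv; rewrite take_size_cat// size_cat.
  rewrite /mkseq -map_take take_iota.
  by rewrite (minn_idPl (leq_addr _ _)).
have [oU CU UW Uloc] := UP i.
have AUE g : ~ (sval A `&` U i g !=set0) -> forall n, T i p (mkseq g n).
  move=> nAU n; apply/negP => /asboolP h; apply: nAU.
  by apply: (h p A g) => //; rewrite size_mkseq.
have AUE' g : sval A `&` U i g !=set0 -> exists n, ~ T i p (mkseq g n).
  move=> [y [Ay Uy]].
  (* Names of the open sets [U i g] that are continuous in [g] let a prefix of [g] and a prefix of
     [p] witness that [U i g] is met. *)
  have [|h ch hP] := @open_curry XX setT (fun g => char (U i g)).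
    move=> g' q x _ qx /asboolP Ux; have [k kP] := Uloc g' q x qx Ux.
    by exists k => g'' q' x' _ qx' gg' qq'; apply/asboolP; exact: kP gg' qx' qq'.
  pose u g' : open_space XX := exist _ (char (U i g')) (open_rep_open hd (oU g')).
  have hu g' : delta (open_space XX) (h g') (u g') by exact: hP.
  have [|k kP] := overt_eval pA (hu g) Ay; first exact/asboolP.
  have [l lP] := agree_uniform ch k (Logic.I : setT g).
  exists (maxn k l); apply/negP; rewrite negbK; apply/asboolP.
  rewrite size_mkseq => p' B g' pB pp' gg'.
  have /agree_mkseq gg : mkseq g (maxn k l) = mkseq g' (maxn k l) by [].
  have [|x Bx /asboolP Ux] := kP _ _ _ _ pB (hu g') (agree_leq (leq_maxl _ _) pp').
    by apply: lP => //; apply: agree_leq gg; exact: leq_maxr.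
  by exists x.
split=> [/asboolP[y [Ay Cy]] [g gT]|nill]; last first.
  apply/asboolP; apply: contrapT => nAC; apply: nill.
  have [||g gW] := UW (~` sval A).
  - by apply: closed_openC; apply: (rep_closed_closed hK hd); exact: svalP A.
  - by move=> x Cx Ax; apply: nAC; exists x.
  by exists g; apply: AUE => -[x [Ax /gW]].
have [|n nT] := AUE' g; first by exists y; split=> //; exact: CU.
exact: nT (gT n).
Qed.

(** That [A] meets a closed set of a scheme is not observable from [A], but a positive answer is a
    nonzero entry in a Sierpinski name, so with the answers a branch can be followed
    continuously. *)
Lemma overt_choice_le_pi11 : weihrauch_le (VC XX) (parallelization id_pi11).
Proof.
have /choice[S SP] := compact_scheme hK.
(* The first entry selects the [K m] in which the point is sought. *)
pose ST s := if s is m :: s' then S m s' else setT.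
have clST s : closed (ST s).
  by case: s => [|m s]; [exact: closedT | have [_ h _ _ _] := SP m; exact: h].
have sST : scheme ST.
  move=> b Sb; pose b' n := b n.+1.
  have bE n : mkseq b n.+1 = b 0%N :: mkseq b' n.
    by rewrite /mkseq /= (iotaDl 1 0) -map_comp.
  have [_ _ _ _ sS] := SP (b 0%N).
  have [|x [xS xU]] := sS b'; first by move=> n; have := Sb n.+1; rewrite bE.
  exists x; split=> [[|n]//|U oU Ux]; first by rewrite bE; exact: xS.
  by have [n nU] := xU U oU Ux; exists n.+1; rewrite bE.
have [|H cH HP] := @pi11_decision (fun i => ST (CodeSeq.decode i)).
  by move=> i; exact: clST.
pose meet (A : set X) s := `[< A `&` ST s !=set0 >].
pose R t p s (A : closed_subset XX) := [/\ t = bpair p s, closed_name p A,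
  sval A !=set0 & forall u, sierp_name (bproj (CodeSeq.code u) s) (meet (sval A) u)].
pose D : set baire := [set t | exists p s A, R t p s A].
pose Q t u := exists p s A, R t p s A /\ sval A `&` ST u !=set0.
pose A0 t : set X := [set x | exists p s A, R t p s A /\ sval A x].
have A0E t p s A : R t p s A -> A0 t = sval A.
  move=> tR; apply/seteqP; split=> x; last by move=> Ax; exists p, s, A.
  move=> [p' [s' [A' [tR' A'x]]]].
  case: tR tR' => -> pA _ _ [/bpair_inj[pp _] pA' _ _].
  by rewrite -pp in pA'; rewrite (closed_name_functional pA pA').
have [|||||F cF FP] := @scheme_selection X K d hK hd D Q A0 ST sST.
- move=> t u _ [p [s [A [[tE pA An0 sA] Au]]]].
  have [j sj] : exists j, bproj (CodeSeq.code u) s j <> 0%N.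
    apply: contrapT => /forallNP s0.
    have /(sA u).2 : forall j, bproj (CodeSeq.code u) s j = 0%N.
      by move=> j; apply: contrapT; exact: s0.
    by rewrite /meet; case: asboolP.
  exists (Cantor.to_nat (CodeSeq.code u, j)).+1.*2 => t' [p' [s' [A' tR']]] tt'.
  exists p', s', A'; split=> //; case: tR' => t'E _ _ sA'.
  rewrite tE t'E in tt'; have [_ ss'] := agree_bpair tt'.
  apply: contrapT => nA'.
  have /(sA' u).1/(_ j) : meet (sval A') u = false by apply/asboolPn.
  by rewrite /bproj -ss'.
- move=> t [p [s [A tR]]]; exists p, s, A; split=> //.
  by case: tR => _ _ [x Ax] _; exists x.
- move=> t [|m u] _ [p [s [A [tR [x [Ax Sx]]]]]].
    have [m Kx] := tower_cover hK x; exists m, p, s, A; split=> //.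
    by exists x; split=> //=; have [-> _ _ _ _] := SP m.
  have [_ _ _ h _] := SP m; have [i Si] := h u x Sx.
  by exists i, p, s, A; split=> //; exists x.
- move=> t u _ [p [s [A [tR [x [Ax Sx]]]]]]; exists x; split=> //.
  by exists p, s, A.
- move=> t [p [s [A tR]]]; rewrite (A0E _ _ _ _ tR).
  by apply: (rep_closed_closed hK hd); exact: svalP A.
apply/weihrauch_leP; exists (fun_map setT H), F; split=> //.
  exact: fun_map_continuous.
move=> p A pA An0.
exists (H p), (fun i => `[< sval A `&` ST (CodeSeq.decode i) !=set0 >]); split=> //.
- exact: HP.
- by exists (fun i => `[< sval A `&` ST (CodeSeq.decode i) !=set0 >]).
move=> s w sw wE; have tR : R (bpair p s) p s A.
  split=> // u; have := sw (CodeSeq.code u).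
  by rewrite (wE (CodeSeq.code u)) /= CodeSeq.codeK.
have [|q [x [Fq qx Ax]]] := FP (bpair p s); first by exists p, s, A.
by exists q, x; split=> //; move: Ax; rewrite (A0E _ _ _ _ tR).
Qed.

End NotFrechetUrysohn.

(** * The trichotomy *)

Theorem corollary68 (R : realType) (X : topologicalType) (d : representation X)
    (hX : copolish R X) (hd : admissible d) :
  let XX := RepSpace d in
  exactly_one
    (polish R X /\ mcontinuous (VC XX))
    (~ @second_countable X /\ frechet_urysohn X /\
       weihrauch_le ACC (VC XX) /\ weihrauch_lt (VC XX) LPO)
    (~ frechet_urysohn X /\
       weihrauch_le LPO (VC XX) /\ weihrauch_le (VC XX) (parallelization id_pi11)).
Proof.
move=> XX; have [K hK] := copolish_tower hX.
have fc : polish R X -> forall x : X, first_countable_at x.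
  by move=> pX x; exact: polish_first_countable pX.
split.
(* Absence of wild points gives the first case; if there is one, the Fréchet-Urysohn property
   decides between the other two. *)
- have [[x wx]|tame] := pselect (exists x, wild K x); last first.
    have {}tame x : ~ wild K x by move=> wx; apply: tame; exists x.
    by left; split; [exact: tame_polish hK tame | exact: (overt_choice_continuous hK)].
  right; have [FU|nFU] := pselect (frechet_urysohn X); [left | right].
    split.
      by move=> /(second_countable_first_countable x)/(first_countable_tame hK).
    split=> //; split; first exact: (ACC_le_overt_choice hK hd FU wx).
    split; first exact: (overt_choice_le_LPO hK hd FU).
    exact: (not_LPO_le_overt_choice hK hd FU).
  split=> //; split; first exact: (LPO_le_overt_choice hK hd nFU).
  exact: (overt_choice_le_pi11 hK hd).
(* A Polish space is first countable, hence has no wild points, hence is second countable. *)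
- move=> [[/fc fX _] [nsc _]]; apply: nsc; apply: (tame_second_countable hK) => x.
  exact: (first_countable_tame hK (fX x)).
- by move=> [[/fc/first_countable_frechet_urysohn ? _] []].
- by move=> [[_ []] ? _ []].
Qed.
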